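(* Let $m\ge 2$ and $1\le k\le m$ be integers, let $1\le p\le\infty$, and let $m'$ and $p'$ be the conjugate exponents of $m$ and $p$ respectively. Put \[ C_{k,m}= \begin{cases} \dfrac{k!\,m^{m/p}}{(m-k)^{(m-k)/p}\,k^{k/p}} & \text{if } 1\le p\le m',\\[2mm] \dfrac{k!\,m^{m/m'}}{(m-k)^{(m-k)/m'}\,k^{k/m'}} & \text{if } m'\le p\le m,\\[2mm] \dfrac{k!\,m^{m/p'}}{(m-k)^{(m-k)/p'}\,k^{k/p'}} & \text{if } m\le p\le\infty. \end{cases} \] Then for every measure $\mu$ and every continuous $m$-homogeneous polynomial $\widehat{L}:L_p(\mu)\to\mathbb{C}$ on the complex space $L_p(\mu)$, \[ \|\widehat{D}^{k}\widehat{L}\|\le C_{k,m}\,\|\widehat{L}\|. \] Moreover, in the case $1\le p\le m'$ the estimate is best possible: $C_{k,m}$ is the smallest constant $C$ such that $\|\widehat{D}^k\widehat{L}\|\le C\|\widehat{L}\|$ holds for every measure $\mu$ and every continuous $m$-homogeneous polynomial $\widehat{L}$ on the complex space $L_p(\mu)$.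
   Context: Conjugate exponents: $q'=q/(q-1)$ for $1<q<\infty$, $1'=\infty$, $\infty'=1$. When $k=m$, the factor $(m-k)^{(m-k)/\cdot}$ is read as $0^0=1$. For a Banach space $X$ over $\mathbb{K}$ ($\mathbb{R}$ or $\mathbb{C}$), a continuous $m$-homogeneous polynomial on $X$ is a map $\widehat{L}:X\to\mathbb{K}$ of the form $\widehat{L}(x)=L(x,\dots,x)$, where $L:X^m\to\mathbb{K}$ is a continuous symmetric $m$-linear form ($L$ is uniquely determined by $\widehat{L}$). Its norm is $\|\widehat{L}\|=\sup\{|\widehat{L}(x)|:\|x\|\le 1\}$. $D^k\widehat{L}(x)$ is the $k$th Fréchet derivative of $\widehat{L}$ at $x$, a continuous symmetric $k$-linear form on $X$, and $\widehat{D}^k\widehat{L}(x)$ is the associated $k$-homogeneous polynomial $y\mapsto D^k\widehat{L}(x)(y,\dots,y)$; explicitly $\widehat{D}^k\widehat{L}(x)y=k!\binom{m}{k}L(\underbrace{x,\dots,x}_{m-k},\underbrace{y,\dots,y}_{k})$. Norms: $\|\widehat{D}^k\widehat{L}(x)\|=\sup_{\|y\|\le 1}|\widehat{D}^k\widehat{L}(x)y|$ and $\|\widehat{D}^k\widehat{L}\|=\sup_{\|x\|\le 1}\|\widehat{D}^k\widehat{L}(x)\|$. *)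

(* Defs.v *)
From HB Require Import structures.
From mathcomp Require Import all_boot all_order all_algebra.
From mathcomp Require Import all_classical all_reals all_analysis.
From mathcomp Require Import perm measurable_realfun ess_sup_inf complex.

Set Implicit Arguments.
Unset Strict Implicit.
Unset Printing Implicit Defensive.

Import Order.TTheory GRing.Theory Num.Theory.
Import numFieldNormedType.Exports.

Local Open Scope classical_set_scope.
Local Open Scope complex_scope.
Local Open Scope ring_scope.

Section modulus.
Variable R : realType.
Implicit Types z w : R[i].

(* The modulus as an element of [R]: [`|z|] itself has type [R[i]]. *)
Definition cabs z : R := complex.Re `|z|.

Lemma cabsE z : (cabs z)%:C = `|z|.
Proof. by rewrite /cabs RRe_real// normr_real. Qed.

Lemma cabs_ge0 z : 0 <= cabs z.
Proof. by rewrite -ler0c cabsE. Qed.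

Lemma cabsD z w : cabs (z + w) <= cabs z + cabs w.
Proof. by rewrite -lecR rmorphD/= !cabsE ler_normD. Qed.

Lemma cabsM z w : cabs (z * w) = cabs z * cabs w.
Proof. by apply: complexI; rewrite rmorphM/= !cabsE normrM. Qed.

Lemma cabs_eq0 z : cabs z = 0 -> z = 0.
Proof. by move=> z0; apply/eqP; rewrite -normr_eq0 -cabsE z0. Qed.

Lemma cabs_sqrt z :
  cabs z = Num.sqrt (complex.Re z ^+ 2 + complex.Im z ^+ 2).
Proof. by apply: complexI; rewrite cabsE normc_def. Qed.

End modulus.

Section complex_Lp.
Context d (T : measurableType d) (R : realType).
Variables (mu : {measure set T -> \bar R}) (p : \bar R) (p1 : (1 <= p)%E).
Implicit Types f g : T -> R[i].

Definition cmeasurable f :=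
  measurable_fun [set: T] (fun t => complex.Re (f t)) /\
  measurable_fun [set: T] (fun t => complex.Im (f t)).

Definition cLnorm f : \bar R := 'N[mu]_p[EFin \o (@cabs R \o f)]%E.

(* [p1] does not occur in the condition; it is an argument so that closure under
   linear combinations can be attached to the predicate. *)
Definition cLfun : {pred T -> R[i]} :=
  let _ := p1 in [pred f | `[< cmeasurable f /\ (cLnorm f < +oo)%E >]].

Lemma cmeasurable_cabs f :
  cmeasurable f -> measurable_fun [set: T] (@cabs R \o f).
Proof.
move=> [mr mi]; rewrite (_ : _ \o f =
  Num.sqrt \o ((fun t => complex.Re (f t) ^+ 2) \+
               (fun t => complex.Im (f t) ^+ 2))); last first.
  by apply/funext => t /=; rewrite cabs_sqrt.
apply: measurableT_comp.
  by apply: continuous_measurable_fun => x; exact: sqrt_continuous.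
by apply: measurable_funD; exact: measurable_funX.
Qed.

Lemma cmeasurableD f g : cmeasurable f -> cmeasurable g -> cmeasurable (f + g).
Proof.
move=> [fr fi] [gr gi]; split.
  rewrite [X in measurable_fun _ X](_ : _ =
      (fun t => complex.Re (f t)) \+ (fun t => complex.Re (g t))).
    exact: measurable_funD.
  by apply/funext => t; rewrite /= fctE; case: (f t) (g t) => [? ?] [].
rewrite [X in measurable_fun _ X](_ : _ =
    (fun t => complex.Im (f t)) \+ (fun t => complex.Im (g t))).
  exact: measurable_funD.
by apply/funext => t; rewrite /= fctE; case: (f t) (g t) => [? ?] [].
Qed.

Lemma cmeasurableZ (a : R[i]) f : cmeasurable f -> cmeasurable (a *: f).
Proof.
move=> [fr fi]; case: a => a b; split.
  rewrite [X in measurable_fun _ X](_ : _ =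
      (fun t => a * complex.Re (f t)) \- (fun t => b * complex.Im (f t))).
    by apply: measurable_funB; exact: measurable_funM.
  by apply/funext => t; rewrite /= fctE; case: (f t).
rewrite [X in measurable_fun _ X](_ : _ =
    (fun t => a * complex.Im (f t)) \+ (fun t => b * complex.Re (f t))).
  by apply: measurable_funD; exact: measurable_funM.
by apply/funext => t; rewrite /= fctE; case: (f t).
Qed.

Let p_gt0 : (0 < p)%E. Proof. exact: lt_le_trans p1. Qed.

Lemma cLnorm_ge0 f : (0 <= cLnorm f)%E.
Proof. exact: Lnorm_ge0. Qed.

Lemma cLnorm0 : cLnorm 0 = 0%E.
Proof.
rewrite /cLnorm -(@Lnorm0 _ T R mu p) ?gt_eqF//; apply: eq_Lnorm => t /=.
by rewrite /cabs normr0.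
Qed.

Let le_Lnorm (f g : T -> R) :
    measurable_fun [set: T] f -> measurable_fun [set: T] g ->
    (forall t, 0 <= f t) -> (forall t, 0 <= g t) ->
    (\forall t \ae mu, f t <= g t) ->
  ('N[mu]_p[EFin \o f] <= 'N[mu]_p[EFin \o g])%E.
Proof.
move=> mf mg f0 g0 fg; have := p1; rewrite unlock; case: p => [r r1| |//] /=.
  have r0 : 0 <= r by apply: le_trans ler01 _; rewrite -lee_fin.
  have mpow (h : T -> R) : measurable_fun [set: T] h ->
      measurable_fun [set: T] (fun t => (`|h t| `^ r)%:E).
    move=> mh; apply/measurable_EFinP.
    apply: (@measurableT_comp _ _ _ _ _ _ (@powR R ^~ r)) => //.
    exact: measurableT_comp.
  apply: gt0_ler_poweR; rewrite ?invr_ge0// ?in_itv/= ?leey ?andbT.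
  - by apply: integral_ge0 => t _; rewrite lee_fin powR_ge0.
  - by apply: integral_ge0 => t _; rewrite lee_fin powR_ge0.
  apply: ae_ge0_le_integral => //; [exact: mpow|exact: mpow|].
  apply: filterS fg => t fgt _.
  by rewrite lee_fin ge0_ler_powR// ?nnegrE// !ger0_norm.
move=> _; case: ifPn => // _; apply: le_ess_sup.
by apply: filterS fg => t fgt /=; rewrite lee_fin !ger0_norm.
Qed.

Let le_cLnorm f g : cmeasurable f -> cmeasurable g ->
  (\forall t \ae mu, cabs (f t) <= cabs (g t)) -> (cLnorm f <= cLnorm g)%E.
Proof.
move=> mf mg fg; apply: le_Lnorm => //; try exact: cmeasurable_cabs.
all: by move=> t; exact: cabs_ge0.
Qed.

Lemma eq_cLnorm f g : cmeasurable f -> cmeasurable g ->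
  f = g %[ae mu] -> cLnorm f = cLnorm g.
Proof.
move=> mf mg fg; apply/eqP; rewrite eq_le !le_cLnorm//.
all: by apply: filterS fg => t /(_ I) ->.
Qed.

Lemma cLnormD f g : cmeasurable f -> cmeasurable g ->
  (cLnorm (f + g)%R <= cLnorm f + cLnorm g)%E.
Proof.
move=> mf mg; have [cf cg] := (cmeasurable_cabs mf, cmeasurable_cabs mg).
apply: le_trans (eminkowski mu cf cg p1).
apply: le_Lnorm => //.
- exact/cmeasurable_cabs/cmeasurableD.
- exact: measurable_funD.
- by move=> t; exact: cabs_ge0.
- by move=> t; rewrite /= addr_ge0// cabs_ge0.
- by apply: nearW => t; exact: cabsD.
Qed.

Lemma cLnormZ (a : R[i]) f : cmeasurable f -> (cLnorm f < +oo)%E ->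
  cLnorm (a *: f) = ((cabs a)%:E * cLnorm f)%E.
Proof.
move=> mf nf; pose h := @cabs R \o f.
have hL : h \in Lfun mu p.
  by rewrite inE; apply/andP; split; rewrite inE//=; exact: cmeasurable_cabs.
have := LnormZ (Lfun_Sub p1 hL) (cabs a); rewrite ger0_norm ?cabs_ge0// => <-.
by rewrite /cLnorm; congr Lnorm; apply/funext => t /=; rewrite fctE cabsM.
Qed.

Lemma cLnorm_eq0 f : cmeasurable f -> cLnorm f = 0%E -> f = 0 %[ae mu].
Proof.
move=> mf /Lnorm_eq0_eq0; have /measurable_EFinP := cmeasurable_cabs mf.
move=> /[swap] /[apply] /(_ p_gt0); apply: filterS => t /= /(_ I) [f0] _.
exact: cabs_eq0.
Qed.

Lemma cLfunP f : reflect (cmeasurable f /\ (cLnorm f < +oo)%E) (f \in cLfun).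
Proof. exact: asboolP. Qed.

Lemma cLfun_submod_closed : submod_closed cLfun.
Proof.
split.
  apply/cLfunP; rewrite cLnorm0; split=> //.
move=> a f g /cLfunP[mf nf] /cLfunP[mg ng]; apply/cLfunP.
have maf := cmeasurableZ a mf; split; first exact: cmeasurableD.
apply: le_lt_trans (cLnormD maf mg) _; rewrite cLnormZ//.
by rewrite lte_add_pinfty// lte_mul_pinfty// lee_fin cabs_ge0.
Qed.

HB.instance Definition _ :=
  GRing.isSubmodClosed.Build R[i] (T -> R[i]) cLfun cLfun_submod_closed.

Record cLfunType := CLfunType {
  cLfun_val :> T -> R[i]; _ : cLfun_val \in cLfun }.

HB.instance Definition _ := [isSub for cLfun_val].
HB.instance Definition _ := [Choice of cLfunType by <:].
HB.instance Definition _ := [SubChoice_isSubLmodule of cLfunType by <:].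

Lemma cLfunType_measurable (f : cLfunType) : cmeasurable f.
Proof. by have /cLfunP[] := valP f. Qed.

Lemma cLfunType_finite (f : cLfunType) : (cLnorm f < +oo)%E.
Proof. by have /cLfunP[] := valP f. Qed.

Definition cae_eq (f g : cLfunType) : bool :=
  `[< (f : T -> R[i]) = g %[ae mu] >].

Let cae_eq_refl : reflexive cae_eq.
Proof. by move=> f; apply/asboolP; exact: ae_eq_refl. Qed.

Let cae_eq_sym : symmetric cae_eq.
Proof.
by move=> f g; apply/idP/idP => /asboolP fg; apply/asboolP; exact: ae_eq_sym.
Qed.

Let cae_eq_trans : transitive cae_eq.
Proof.
move=> g f h /asboolP fg /asboolP gh; apply/asboolP; exact: ae_eq_trans gh.
Qed.

Canonical cae_eq_equiv := EquivRel cae_eq cae_eq_refl cae_eq_sym cae_eq_trans.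

Local Open Scope quotient_scope.

(* The complex space [L_p(mu)], its elements being classes of functions. *)
Definition cLspace : Type := {eq_quot cae_eq}.
HB.instance Definition _ := Choice.on cLspace.
HB.instance Definition _ := EqQuotient.on cLspace.

Local Notation "\pi f" := (\pi_cLspace f) (at level 10).

Lemma cLspace_eqP (f g : cLfunType) :
  \pi f = \pi g <-> (f : T -> R[i]) = g %[ae mu].
Proof.
split=> [/eqP|fg]; first by rewrite eqmodE => /asboolP.
by apply/eqP; rewrite eqmodE; apply/asboolP.
Qed.

Lemma cLspace_repr (f : cLfunType) : (repr (\pi f) : T -> R[i]) = f %[ae mu].
Proof. by apply/cLspace_eqP; rewrite reprK. Qed.

Definition cLspace_add (u v : cLspace) : cLspace := \pi (repr u + repr v).
Definition cLspace_opp (u : cLspace) : cLspace := \pi (- repr u).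
Definition cLspace_scale (a : R[i]) (u : cLspace) : cLspace :=
  \pi (a *: repr u).
Definition cLspace_norm (u : cLspace) : R[i] := (fine (cLnorm (repr u)))%:C.

Lemma pi_cLspaceD (f g : cLfunType) : cLspace_add (\pi f) (\pi g) = \pi (f + g).
Proof.
apply/cLspace_eqP; apply: filterS2 (cLspace_repr f) (cLspace_repr g).
by move=> t + + _ => /(_ I) /= ft /(_ I) /= gt; rewrite !fctE ft gt.
Qed.

Lemma pi_cLspaceN (f : cLfunType) : cLspace_opp (\pi f) = \pi (- f).
Proof.
apply/cLspace_eqP; apply: filterS (cLspace_repr f).
by move=> t + _ => /(_ I) /= ft; rewrite !fctE ft.
Qed.

Lemma pi_cLspaceZ a (f : cLfunType) : cLspace_scale a (\pi f) = \pi (a *: f).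
Proof.
apply/cLspace_eqP; apply: filterS (cLspace_repr f).
by move=> t + _ => /(_ I) /= ft; rewrite !fctE ft.
Qed.

Lemma cLspace_normE (f : cLfunType) :
  cLspace_norm (\pi f) = (fine (cLnorm f))%:C.
Proof.
by rewrite /cLspace_norm (eq_cLnorm _ _ (cLspace_repr f))//;
  exact: cLfunType_measurable.
Qed.

Let cLspaceA : associative cLspace_add.
Proof.
move=> u v w; elim/quotW: u => f; elim/quotW: v => g; elim/quotW: w => h.
by rewrite (pi_cLspaceD g h) (pi_cLspaceD f g) (pi_cLspaceD f (g + h))
  (pi_cLspaceD (f + g) h) addrA.
Qed.

Let cLspaceC : commutative cLspace_add.
Proof.
move=> u v; elim/quotW: u => f; elim/quotW: v => g.
by rewrite !pi_cLspaceD addrC.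
Qed.

Let cLspace_add0 : left_id (\pi 0) cLspace_add.
Proof. by move=> u; elim/quotW: u => f; rewrite pi_cLspaceD add0r. Qed.

Let cLspace_addN : left_inverse (\pi 0) cLspace_opp cLspace_add.
Proof.
by move=> u; elim/quotW: u => f; rewrite pi_cLspaceN pi_cLspaceD addNr.
Qed.

HB.instance Definition _ := GRing.isZmodule.Build cLspace
  cLspaceA cLspaceC cLspace_add0 cLspace_addN.

Let cLspace_scaleA a b u :
  cLspace_scale a (cLspace_scale b u) = cLspace_scale (a * b) u.
Proof.
elim/quotW: u => f.
by rewrite (pi_cLspaceZ b f) (pi_cLspaceZ a (b *: f)) (pi_cLspaceZ (a * b) f)
  scalerA.
Qed.

Let cLspace_scale1 : left_id 1 cLspace_scale.
Proof. by move=> u; elim/quotW: u => f; rewrite pi_cLspaceZ scale1r. Qed.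

Let cLspace_scaleDr : right_distributive cLspace_scale +%R.
Proof.
move=> a u v; elim/quotW: u => f; elim/quotW: v => g.
rewrite -[\pi f + \pi g]/(cLspace_add (\pi f) (\pi g)) (pi_cLspaceD f g).
by rewrite (pi_cLspaceZ a (f + g)) (pi_cLspaceZ a f) (pi_cLspaceZ a g) scalerDr
  -pi_cLspaceD.
Qed.

Let cLspace_scaleDl u : {morph cLspace_scale^~ u : a b / a + b}.
Proof.
move=> a b; elim/quotW: u => f /=.
by rewrite (pi_cLspaceZ (a + b) f) (pi_cLspaceZ a f) (pi_cLspaceZ b f) scalerDl
  -pi_cLspaceD.
Qed.

HB.instance Definition _ := GRing.Zmodule_isLmodule.Build R[i] cLspace
  cLspace_scaleA cLspace_scale1 cLspace_scaleDr cLspace_scaleDl.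

Let cLnorm_fin (f : cLfunType) : cLnorm f \is a fin_num.
Proof. by rewrite ge0_fin_numE ?cLnorm_ge0// cLfunType_finite. Qed.

Let cLspace_ler_normD u v :
  cLspace_norm (u + v) <= cLspace_norm u + cLspace_norm v.
Proof.
elim/quotW: u => f; elim/quotW: v => g.
rewrite [X in cLspace_norm X](pi_cLspaceD f g) !cLspace_normE -rmorphD/= lecR.
rewrite -lee_fin EFinD (fineK (cLnorm_fin f)) (fineK (cLnorm_fin g)).
rewrite (fineK (cLnorm_fin (f + g))).
by apply: (@cLnormD f g); exact: cLfunType_measurable.
Qed.

Let cLspace_normZ (a : R[i]) u : cLspace_norm (a *: u) = `|a| * cLspace_norm u.
Proof.
elim/quotW: u => f.
rewrite [X in cLspace_norm X](pi_cLspaceZ a f) !cLspace_normE -cabsE -rmorphM/=.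
rewrite cLnormZ ?fineM//; [exact: cLfunType_measurable|exact: cLfunType_finite].
Qed.

Let cLspace_norm0_eq0 u : cLspace_norm u = 0 -> u = 0.
Proof.
elim/quotW: u => f; rewrite cLspace_normE => -[f0]; apply/cLspace_eqP.
apply: cLnorm_eq0; first exact: cLfunType_measurable.
by rewrite -[LHS]fineK// f0.
Qed.

HB.instance Definition _ := Lmodule_isNormed.Build R[i] cLspace
  cLspace_ler_normD cLspace_normZ cLspace_norm0_eq0.

End complex_Lp.

Section polynomials.
Variables (R : realType) (X : normedModType R[i]).

Definition multilinear n (A : ('I_n -> X) -> R[i]) :=
  forall (i : 'I_n) (x : 'I_n -> X) (a : R[i]) (u v : X),
    A (dfwith x i (a *: u + v)) = a * A (dfwith x i u) + A (dfwith x i v).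

Definition symmetric_form n (A : ('I_n -> X) -> R[i]) :=
  forall (s : 'S_n) (x : 'I_n -> X), A (x \o s) = A x.

Definition continuous_form n (A : ('I_n -> X) -> R[i]) :=
  continuous (A : {ptws 'I_n -> X} -> R[i]^o).

Definition continuous_homogeneous_polynomial m (P : X -> R[i]) :=
  exists L : ('I_m -> X) -> R[i],
    [/\ multilinear L, symmetric_form L, continuous_form L &
        forall x, P x = L (fun=> x)].

Definition form_norm n (A : ('I_n -> X) -> R[i]) : \bar R :=
  ereal_sup [set (cabs (A y))%:E | y in [set y | forall i, `|y i| <= 1]].

Definition fcons n (h : X) (y : 'I_n -> X) : 'I_n.+1 -> X :=
  fun i => oapp y h (unlift ord0 i).

(* The Frechet derivative at [x] of a map [G] with values in the space of
   continuous [n]-linear forms normed by [form_norm]. Linear maps from [X] to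
   that space are identified with [n.+1]-linear forms, the direction of
   differentiation being the first argument. *)
Definition is_frechet_derivative n (G : X -> ('I_n -> X) -> R[i]) (x : X)
    (A : ('I_n.+1 -> X) -> R[i]) :=
  [/\ multilinear A, continuous_form A &
      forall e : R, 0 < e -> \forall h \near (0 : X),
        (form_norm (fun y => (G (x + h) y - G x y - A (fcons h y))%R)
           <= (e * complex.Re `|h|)%:E)%E].

(* The [k]-th Frechet derivative; the value is [0] at points where a derivative
   does not exist, which never happens for continuous polynomials. *)
Fixpoint frechet k (f : X -> R[i]) : X -> ('I_k -> X) -> R[i] :=
  if k is k'.+1 then
    fun x => xget (fun=> 0) (is_frechet_derivative (@frechet k' f) x)
  else fun x _ => f x.

Definition frechet_polynomial k (f : X -> R[i]) (x y : X) : R[i] :=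
  @frechet k f x (fun=> y).

Definition poly_norm (P : X -> R[i]) : \bar R :=
  ereal_sup [set (cabs (P x))%:E | x in [set x | `|x| <= 1]].

Definition frechet_norm k (P : X -> R[i]) : \bar R :=
  ereal_sup
    [set poly_norm (frechet_polynomial k P x) | x in [set x | `|x| <= 1]].

End polynomials.

Section constant.
Variable R : realType.

(* The exponent [p], [m'] or [p'] that occurs in the constant; it is finite in
   each of the three ranges of [p] when [1 <= p] and [2 <= m]. *)
Definition bound_exponent (m : nat) (p : \bar R) : R :=
  let m' := hoelder_conjugate m%:R%:E in
  fine (if (p <= m')%E then p
        else if (p <= m%:R%:E)%E then m'
        else hoelder_conjugate p).

(* [0 `^ 0 = 1], which is the convention needed when [k = m]. *)
Definition bound_constant (k m : nat) (p : \bar R) : R :=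
  let r := bound_exponent m p in
  k`!%:R * m%:R `^ (m%:R / r) /
  ((m - k)%:R `^ ((m - k)%:R / r) * k%:R `^ (k%:R / r)).

End constant.

(* Main.v *)
(** For unit vectors x, y of a space X and weights a, b >= 0, the number
    'C(m, k) a^(m-k) b^k L(x, .., x, y, .., y) is a Fourier coefficient of
    t |-> P(a x + b e^(it) y), so averaging over roots of unity bounds it by
    ||P|| times the mean of ||a x + b e^(it) y||^m.  Pairing e^(it) with its
    opposite, a two-point inequality
      ||u + v||^m + ||u - v||^m <= 2 (||u||^r + ||v||^r)^(m/r)
    bounds that mean by 1 when a^r = (m-k)/m and b^r = k/m, and this choice of
    a, b produces the constant.

    In L_p, put q = max(p, m), q' = q/(q-1) and r = min(p, q'), which is the
    exponent of the statement.  The two-point inequality with q in place of m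
    follows from Clarkson's scalar inequality
      |z + w|^q + |z - w|^q <= 2 (|z|^q' + |w|^q')^(q-1)
    by two applications of Minkowski's inequality (one for the exponent
    q/p >= 1 on two points, one for p/q' when p >= q'); convexity then lowers
    q to m.

    For p <= m' the monomial x_1^k x_2^(m-k) on the two-dimensional l_p is
    extremal, its norm being given by the weighted AM-GM inequality. *)

Require Import Defs.
From mathcomp Require Import all_boot all_order all_algebra.
From mathcomp Require Import all_classical all_reals all_analysis.
From mathcomp Require Import cyclic separable cyclotomic.
From mathcomp Require Import perm measurable_realfun complex ring lra.

Set Implicit Arguments.
Unset Strict Implicit.
Unset Printing Implicit Defensive.

Import Order.TTheory GRing.Theory Num.Theory.
Import numFieldNormedType.Exports.

Local Open Scope classical_set_scope.
Local Open Scope complex_scope.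
Local Open Scope ring_scope.

(** * Clarkson's scalar inequality *)

Section clarkson_scalar.
Variable R : realType.
Implicit Types (a b x al q : R).

Lemma one_powR (s : R) : 1 `^ s = 1 :> R.
Proof. by rewrite powR1. Qed.

(** For [n = 0] the power is 0^0 = 1, so the denominators of the constant are positive also when
    [k = m]. *)
Lemma powR_nat_self_gt0 (n : nat) (s : R) : 0 < n%:R `^ (n%:R / s) :> R.
Proof. by case: n => [|n]; rewrite ?mul0r ?powRr0// powR_gt0// ltr0n. Qed.

(** Each fraction c/(a+b) lies in [0, 1] and is therefore at most its s-th power; the cases c = a
    and c = b are added. *)
Lemma powRD_le a b (s : R) : 0 <= a -> 0 <= b -> 0 < s -> s <= 1 ->
  (a + b) `^ s <= a `^ s + b `^ s.
Proof.
move=> a0 b0 s0 s1.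
have [->|ab_neq0] := eqVneq (a + b) 0.
  by rewrite powR0 ?gt_eqF// addr_ge0 ?powR_ge0.
have ab0 : 0 < a + b by rewrite lt_neqAle eq_sym ab_neq0 addr_ge0.
have key c : 0 <= c -> c <= a + b -> c / (a + b) * (a + b) `^ s <= c `^ s.
  rewrite le_eqVlt => /predU1P[<- _|c0 cab]; first by rewrite !mul0r powR_ge0.
  rewrite -[in leRHS](divfK ab_neq0 c) powRM ?divr_ge0 ?(ltW c0) ?(ltW ab0)//.
  rewrite ler_wpM2r ?powR_ge0// ger1_powR// divr_gt0//=.
  by rewrite ler_pdivrMr// mul1r.
rewrite -[leLHS]mul1r -(divff ab_neq0).
by rewrite mulrDl mulrDl lerD// key// ?lerDl// lerDr.
Qed.

(* Friedrichs' interpolation: at [al = 1] this is [(1 + x)^q + (1 - x)^q]; at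
   [al = x^(1/(q-1))] the second summand vanishes and the first one is
   [2 (1 + x^(q/(q-1)))^(q-1)]. *)
Definition friedrichs q x al : R :=
  (1 + al `^ (1 - q) * x) * (1 + al * x) `^ (q - 1) +
  (1 - al `^ (1 - q) * x) * (1 - al * x) `^ (q - 1).

(** The derivative is put in factored form so that its sign can be read off factor by factor. *)
Lemma is_derive_friedrichs q x al : 0 < x < 1 -> 0 < al <= 1 ->
  is_derive al 1 (friedrichs q x)
    ((q - 1) * x * (1 - al `^ (- q)) *
      ((1 + al * x) `^ (q - 2) - (1 - al * x) `^ (q - 2))).
Proof.
move=> /andP[x0 x1] /andP[al0 al1].
have alx0 : 0 < al * x by exact: mulr_gt0.
have alx1 : al * x < 1 by nra.
have dp c (c0 : 0 < 1 + c * (al * x)) :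
    is_derive al 1 (fun t : R => (1 + c * (t * x)) `^ (q - 1))
      (((q - 1) * (1 + c * (al * x)) `^ (q - 1 - 1)) * (c * x)).
  have dl : is_derive al 1 (fun t : R => 1 + c * (t * x)) (c * x).
    rewrite [X in is_derive _ _ X](_ : _ = cst 1 + (c * x) *: id); last first.
      by apply/funext => t; rewrite !fctE /GRing.scale/=; ring.
    apply: (is_derive_eq (is_deriveD (is_derive_cst _ _ _)
        (is_deriveZ _ (is_derive_id al 1)))).
    by rewrite add0r /GRing.scale/= mulr1.
  have := @is_derive1_comp R (@powR R ^~ (q - 1))
    (fun t : R => 1 + c * (t * x)) al _ _ (is_derive1_powR (q - 1) c0) dl.
  by move=> h; apply: (is_derive_eq h); rewrite /GRing.scale/= mulrC.
have du := is_derive1_powR (1 - q) al0.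
have := dp 1 ltac:(lra); have := dp (-1) ltac:(lra).
rewrite [X in is_derive _ _ X _](_ : _ = (fun t : R => (1 - t * x) `^ (q - 1))); last first.
  by apply/funext => t; congr (_ `^ _); ring.
rewrite [X in _ -> is_derive _ _ X _ -> _](_ : _ =
  (fun t : R => (1 + t * x) `^ (q - 1))); last first.
  by apply/funext => t; congr (_ `^ _); ring.
move=> dm {}dp.
rewrite [friedrichs q x](_ : _ =
   (cst 1 + x *: (@powR R ^~ (1 - q))) * (fun t : R => (1 + t * x) `^ (q - 1))
 + (cst 1 - x *: (@powR R ^~ (1 - q))) * (fun t : R => (1 - t * x) `^ (q - 1))); last first.
  apply/funext => t; rewrite /friedrichs !fctE /GRing.scale/=.
  by rewrite [x * _]mulrC.
apply: (is_derive_eq (is_deriveD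
  (is_deriveM (is_deriveD (is_derive_cst _ _ _) (is_deriveZ x du)) dp)
  (is_deriveM (is_deriveB (is_derive_cst _ _ _) (is_deriveZ x du)) dm))).
rewrite !fctE /GRing.scale/=.
(* Once all powers are expressed through the exponents [- q] and [q - 2], a polynomial identity
   remains. *)
have -> : 1 - q - 1 = - q by ring.
have -> : al `^ (1 - q) = al * al `^ (- q).
  by rewrite powRD ?powRr1 1?ltW// (gt_eqF al0) implybT.
have -> : q - 1 - 1 = q - 2 by ring.
have e c : 0 < c -> c `^ (q - 1) = c * c `^ (q - 2).
  move=> c0; rewrite (_ : q - 1 = 1 + (q - 2)); last by ring.
  by rewrite (@powRD _ c 1) ?(gt_eqF c0) ?implybT// powRr1// ltW.
rewrite mul1r !mulN1r !e; [|lra|lra].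
have -> : x *: (al * al `^ (- q)) = x * (al * al `^ (- q)) by [].
ring.
Qed.

(** The function decreases on [al, 1]: for t <= 1 the factor 1 - t^(-q) is nonpositive, and q >= 2
    makes the difference of the two powers nonnegative. *)
Lemma friedrichs_le q x al : 2 <= q -> 0 < x < 1 -> 0 < al <= 1 ->
  friedrichs q x 1 <= friedrichs q x al.
Proof.
move=> q2 x01 /andP[al0 al1].
have [x0 x1] := andP x01.
have dF t : al <= t -> t <= 1 -> is_derive t 1 (friedrichs q x)
    ((q - 1) * x * (1 - t `^ (- q)) *
      ((1 + t * x) `^ (q - 2) - (1 - t * x) `^ (q - 2))).
  move=> alt t1; apply: is_derive_friedrichs => //.
  by rewrite t1 andbT (lt_le_trans al0).
apply: (@ler0_derive1_le_cc _ (friedrichs q x) al 1) => //.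
- by move=> t; rewrite in_itv/= => /andP[h1 h2]; have [] := dF t (ltW h1) (ltW h2).
- move=> t; rewrite in_itv/= => /andP[h1 h2].
  rewrite derive1E; have [_ ->] := dF t (ltW h1) (ltW h2).
  have tx : 0 < t * x by rewrite mulr_gt0//; lra.
  have tx1 : t * x < 1 by nra.
  rewrite -[leLHS]mulrA mulr_ge0_le0//; first by rewrite mulr_ge0//; lra.
  rewrite mulr_le0_ge0//.
    rewrite subr_le0 powRN.
    rewrite invf_ge1 ?powR_gt0 ?(lt_trans al0)//.
    rewrite -[leRHS](one_powR q).
    rewrite ge0_ler_powR ?nnegrE//; lra.
  rewrite subr_ge0 ge0_ler_powR ?nnegrE//; lra.
- apply: derivable_within_continuous => t; rewrite in_itv/= => /andP[h1 h2].
  by have [] := dF t h1 h2.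
- by rewrite in_itv/= lexx al1.
- by rewrite in_itv/= lexx al1.
Qed.

(** For 0 < x < 1 the interpolation is compared at 1 and at x^(1/(q-1)). The ends x = 0 and x = 1,
    where equality holds, lie outside its range and are checked directly. *)
Lemma clarkson_unit q x : 2 <= q -> 0 <= x <= 1 ->
  (1 + x) `^ q + (1 - x) `^ q <= 2 * (1 + x `^ (q / (q - 1))) `^ (q - 1).
Proof.
move=> q2 /andP[]; rewrite le_eqVlt => /predU1P[<- _|x0].
  rewrite addr0 subr0 powR0; first by rewrite addr0 !powR1; lra.
  by rewrite gt_eqF// divr_gt0; lra.
rewrite le_eqVlt => /predU1P[->|x1].
  rewrite subrr powR1 (@powR0 _ q) ?addr0; last by rewrite gt_eqF//; lra.
  by rewrite mulr_powRB1//; lra.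
have q0 : q - 1 != 0 by rewrite gt_eqF//; lra.
set al := x `^ (q - 1)^-1.
have al01 : 0 < al <= 1.
  rewrite powR_gt0//= -[leRHS](one_powR (q - 1)^-1) ge0_ler_powR ?nnegrE ?invr_ge0//; lra.
have := friedrichs_le q2 (introT andP (conj x0 x1)) al01.
rewrite /friedrichs powR1 !mul1r.
rewrite !mulr_powRB1; [|lra..].
rewrite -powRrM (_ : _^-1 * (1 - q) = -1); last by field.
rewrite powRN (powRr1 (ltW x0)) mulVf ?gt_eqF// subrr mul0r addr0.
move=> /le_trans; apply.
rewrite (_ : al * x = x `^ (q / (q - 1)))//.
rewrite -[in LHS](powRr1 (ltW x0)) /al powRr1 1?ltW//.
rewrite -[X in _ * X](powRr1 (ltW x0)) -powRD ?(gt_eqF x0) ?implybT//.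
by congr (_ `^ _); field.
Qed.

(** Both sides are homogeneous of degree q, so division by [a] reduces the claim to the ratio b/a in
    [0, 1]. *)
Lemma clarkson_nonneg q a b : 2 <= q -> 0 <= b -> b <= a ->
  (a + b) `^ q + (a - b) `^ q <=
    2 * (a `^ (q / (q - 1)) + b `^ (q / (q - 1))) `^ (q - 1).
Proof.
move=> q2 b0 ba; have [a0|a0] := eqVneq a 0.
  have b00 : b = 0 by apply/eqP; rewrite eq_le b0 -a0 ba.
  by rewrite a0 b00 addr0 subr0 powR0 ?addr0 ?mulr_ge0 ?powR_ge0// gt_eqF//; lra.
have {}a0 : 0 < a by rewrite lt_neqAle eq_sym a0 (le_trans b0).
have x01 : 0 <= b / a <= 1.
  by rewrite divr_ge0 ?(ltW a0)//= ler_pdivrMr// mul1r.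
have eb : b = a * (b / a) by rewrite mulrC divfK ?gt_eqF.
have := clarkson_unit q2 x01; move: (b / a) eb x01 => x -> /andP[x0 x1] le.
rewrite -[X in (X + _) `^ _ + _]mulr1 -mulrDr.
rewrite -[X in _ + (X - _) `^ _]mulr1 -mulrBr.
rewrite !powRM ?subr_ge0 ?addr_ge0 ?(ltW a0)//.
rewrite -mulrDr -[X in _ * (X + _) `^ _]mulr1 -mulrDr powRM ?addr_ge0 ?powR_ge0//.
rewrite -powRrM divfK; last by rewrite gt_eqF//; lra.
by rewrite mulrCA ler_pM2l// powR_gt0.
Qed.

(* Karamata's inequality for two points and the convex function [powR ^~ c]. *)
Lemma powR_majorization (c X Y M m : R) : 1 <= c -> 0 <= m ->
  m <= X -> X <= M -> X + Y = M + m -> X `^ c + Y `^ c <= M `^ c + m `^ c.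
Proof.
move=> c1 m0 mX XM e; have [Mm|Mm] := eqVneq M m.
  by rewrite (_ : X = m) 1?(_ : Y = m) ?Mm//; lra.
have {}Mm : 0 < M - m by rewrite subr_gt0 lt_neqAle eq_sym Mm (le_trans mX).
(* [X] is the combination of [M] and [m] with weight [l], and [Y] is the mirrored one; convexity is
   used once for each. *)
pose l := (X - m) / (M - m).
have l0 : 0 <= l by rewrite divr_ge0 ?(ltW Mm)// subr_ge0.
have l1 : l <= 1 by rewrite ler_pdivrMr// mul1r lerD2r.
have eX : X = l * M + (1 - l) * m.
  by rewrite /l; field; rewrite gt_eqF.
have eY : Y = l * m + (1 - l) * M by rewrite (_ : Y = M + m - X) ?eX; lra.
have M0 : 0 <= M by lra.
have nn t : 0 <= t -> t \in (`[0, +oo[%classic : set R).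
  by move=> t0; rewrite inE/= in_itv/= t0.
have := convex_powR c1 (Itv01 l0 l1) (nn _ M0) (nn _ m0).
have := convex_powR c1 (Itv01 l0 l1) (nn _ m0) (nn _ M0).
rewrite convRE [X in X `^ _ <= _]convRE /= => h.
rewrite convRE [X in X `^ _ <= _]convRE /=; move: h.
by rewrite /unstable.onem -eX -eY; lra.
Qed.


Lemma cabs_sqr (z : R[i]) : cabs z ^+ 2 = complex.Re z ^+ 2 + complex.Im z ^+ 2.
Proof. by rewrite cabs_sqrt sqr_sqrtr// addr_ge0// sqr_ge0. Qed.

Lemma cabsN (z : R[i]) : cabs (- z) = cabs z.
Proof. by rewrite /cabs normrN. Qed.

Lemma cabsB_le (z w : R[i]) : cabs z - cabs w <= cabs (z - w).
Proof. by rewrite lerBlDr -{1}(subrK w z) cabsD. Qed.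

Lemma parallelogram (z w : R[i]) :
  cabs (z + w) ^+ 2 + cabs (z - w) ^+ 2 = 2 * (cabs z ^+ 2 + cabs w ^+ 2).
Proof. by rewrite !cabs_sqr; case: z w => [a b] [c d] /=; ring. Qed.

Lemma powR_sqr (x s : R) : 0 <= x -> (x ^+ 2) `^ (s / 2) = x `^ s.
Proof.
move=> x0; rewrite -powR_mulrn// -powRrM; congr (_ `^ _).
by rewrite mulrC divfK.
Qed.

(* By the parallelogram law, the pair [|z + w|^2, |z - w|^2] is majorized by
   [(|z| + |w|)^2, (|z| - |w|)^2], which reduces to the nonnegative case. *)
Lemma clarkson_complex (q : R) (z w : R[i]) : 2 <= q ->
  cabs (z + w) `^ q + cabs (z - w) `^ q <=
    2 * (cabs z `^ (q / (q - 1)) + cabs w `^ (q / (q - 1))) `^ (q - 1).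
Proof.
(* By symmetry |w| <= |z|, so that |z| - |w| is nonnegative. *)
move=> q2; wlog wz : z w / cabs w <= cabs z => [H|].
  have [/H//|/ltW/H] := leP (cabs w) (cabs z).
  by rewrite [w + z]addrC -[w - z]opprB cabsN [cabs w `^ _ + _]addrC.
apply: le_trans (clarkson_nonneg q2 (cabs_ge0 w) wz).
have zw := cabs_ge0 z; have w0 := cabs_ge0 w.
have tD := cabsD z w; have tB := cabsD z (- w); rewrite cabsN in tB.
have bD := cabsB_le z (- w); have bB := cabsB_le z w.
rewrite opprK cabsN in bD.
rewrite -(powR_sqr q (cabs_ge0 (z + w))) -(powR_sqr q (cabs_ge0 (z - w))).
rewrite -(@powR_sqr (cabs z + cabs w)) ?addr_ge0//.
rewrite -(@powR_sqr (cabs z - cabs w)) ?subr_ge0//.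
apply: powR_majorization; first by lra.
- exact: sqr_ge0.
- by rewrite lerXn2r// ?nnegrE ?subr_ge0 ?cabs_ge0.
- by rewrite lerXn2r// ?nnegrE ?addr_ge0 ?cabs_ge0.
- by rewrite parallelogram; ring.
Qed.

End clarkson_scalar.

(** * The two-point inequality for the [L_p] norm *)

Section Lp_inequalities.
Context d (T : measurableType d) (R : realType).
Variable mu : {measure set T -> \bar R}.
Implicit Types (F G : T -> R) (p q r s t : R).

Lemma measurable_fun_powR F p : measurable_fun [set: T] F ->
  measurable_fun [set: T] (fun x => F x `^ p).
Proof. by move=> mF; apply: (@measurableT_comp _ _ _ _ _ _ (@powR R ^~ p)). Qed.

(* Minkowski's inequality in the form
   [`|(\int F, \int G)|_t <= \int `|(F, G)|_t] for the [t]-norm on pairs; it is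
   proved by testing against [(S^(t-1), D^(t-1))] and Hoelder's inequality. *)
Lemma integral_pair_powR F G (S D W t : R) : 1 <= t ->
  measurable_fun [set: T] F -> measurable_fun [set: T] G ->
  (forall x, 0 <= F x) -> (forall x, 0 <= G x) -> 0 <= S -> 0 <= D ->
  (\int[mu]_x (F x)%:E = S%:E)%E -> (\int[mu]_x (G x)%:E = D%:E)%E ->
  (\int[mu]_x ((F x `^ t + G x `^ t) `^ t^-1)%:E <= W%:E)%E ->
  S `^ t + D `^ t <= W `^ t.
Proof.
move=> t1 mF mG F0 G0 S0 D0 iF iG iW.
have t0 : 0 < t by lra.
pose H x := (F x `^ t + G x `^ t) `^ t^-1.
have {}iW : (\int[mu]_x (H x)%:E <= W%:E)%E by exact: iW.
have H0 x : 0 <= H x by exact: powR_ge0.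
have mH : measurable_fun [set: T] H.
  by apply: measurable_fun_powR; apply: measurable_funD; exact: measurable_fun_powR.
have W0 : 0 <= W.
  rewrite -lee_fin; apply: le_trans iW; apply: integral_ge0 => x _.
  by rewrite lee_fin powR_ge0.
set A := S `^ t + D `^ t.
have A0 : 0 <= A by rewrite addr_ge0 ?powR_ge0.
(* Dividing by A^(1 - 1/t) and raising to the power t gives the claim; A = 0 is trivial. *)
suff key : A <= A `^ (1 - t^-1) * W.
  have [->|An0] := eqVneq A 0; first exact: powR_ge0.
  have Agt0 : 0 < A by rewrite lt_neqAle eq_sym An0.
  have : A `^ t^-1 <= W.
    rewrite -(@ler_pM2l _ (A `^ (1 - t^-1))) ?powR_gt0// -powRD ?An0 ?implybT//.
    by rewrite subrK powRr1.
  have tn0 : t != 0 by rewrite gt_eqF.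
  move=> AW; rewrite -[leLHS](powRr1 A0) -(mulVf tn0) powRrM.
  by rewrite ge0_ler_powR ?nnegrE ?powR_ge0// ltW.
pose c := S `^ (t - 1); pose e := D `^ (t - 1).
have c0 : 0 <= c by exact: powR_ge0.
have e0 : 0 <= e by exact: powR_ge0.
have eA : A = c * S + e * D.
  by rewrite /c /e ![_ `^ (t - 1) * _]mulrC !mulr_powRB1.
(* Hoelder's inequality on two points. For t = 1 the conjugate exponent is infinite, but then both
   weights are 1 and equality holds. *)
have point x : c * F x + e * G x <= A `^ (1 - t^-1) * H x.
  have [t_eq1|t_neq1] := eqVneq t 1.
    rewrite /H /c /e t_eq1 subrr invr1 subrr !powRr0 !mul1r !powRr1//.
    by rewrite addr_ge0 ?powR_ge0.
  have {}t1 : 0 < t - 1 by rewrite subr_gt0 lt_neqAle eq_sym t_neq1.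
  have tn0 : t - 1 != 0 by rewrite gt_eqF.
  have tn : t != 0 by rewrite gt_eqF.
  have t'0 : 0 < t / (t - 1) by exact: divr_gt0.
  have tt' : (t / (t - 1))^-1 + t^-1 = 1 by rewrite invf_div -[X in _ + X]mul1r -mulrDl subrK divff.
  have := hoelder2 c0 e0 (F0 x) (G0 x) t'0 t0 tt'.
  rewrite /c /e -!powRrM (_ : (t - 1) * (t / (t - 1)) = t); last by field.
  by rewrite (_ : (t / (t - 1))^-1 = 1 - t^-1)//; field; rewrite tn.
have KA0 : 0 <= A `^ (1 - t^-1) by exact: powR_ge0.
rewrite -lee_fin {1}eA EFinD !EFinM; clearbody H c e; clear eA; clearbody A.
move: (A `^ _) KA0 point => K K0 point.
rewrite -iF -iG.
rewrite -!ge0_integralZl_EFin//; do ?by move=> x _; rewrite lee_fin.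
all: do ?exact/measurable_EFinP.
rewrite -ge0_integralD//; do ?by move=> x _; rewrite -EFinM lee_fin mulr_ge0.
all: do ?by apply/measurable_EFinP; exact: measurable_funM.
apply: (@le_trans _ _ (\int[mu]_x (K%:E * (H x)%:E))%E).
  apply: ge0_le_integral => //.
  - by move=> x _; rewrite -!EFinM -EFinD lee_fin addr_ge0 ?mulr_ge0.
  - by apply: emeasurable_funD; apply/measurable_EFinP; exact: measurable_funM.
  - by apply/measurable_EFinP; exact: measurable_funM.
  - by move=> x _; have := point x; rewrite -lee_fin EFinD !EFinM.
rewrite ge0_integralZl_EFin//; last 2 first.
  by move=> x _; rewrite lee_fin.
  exact/measurable_EFinP.
by rewrite lee_wpmul2l.
Qed.

(** If p <= s, the power p/s <= 1 is subadditive and the bound holds pointwise. If s < p, it is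
    Minkowski's inequality with exponent p/s for F^s and G^s. *)
Lemma integral_sum_powR F G (a b p s : R) : 1 <= p -> 0 < s ->
  measurable_fun [set: T] F -> measurable_fun [set: T] G ->
  (forall x, 0 <= F x) -> (forall x, 0 <= G x) -> 0 <= a -> 0 <= b ->
  (\int[mu]_x (F x `^ p)%:E = (a `^ p)%:E)%E ->
  (\int[mu]_x (G x `^ p)%:E = (b `^ p)%:E)%E ->
  (\int[mu]_x ((F x `^ s + G x `^ s) `^ (p / s))%:E <=
    ((a `^ Num.min p s + b `^ Num.min p s) `^ (p / Num.min p s))%:E)%E.
Proof.
move=> p1 s0 mF mG F0 G0 a0 b0 iF iG.
have p0 : 0 < p by lra.
have [ps|sp] := leP p s.
  rewrite divff ?gt_eqF// powRr1 ?addr_ge0 ?powR_ge0//.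
  rewrite EFinD -iF -iG -ge0_integralD//; do ?by move=> x _; rewrite lee_fin powR_ge0.
  all: do ?by apply/measurable_EFinP; exact: measurable_fun_powR.
  apply: ge0_le_integral => //.
  - by move=> x _; rewrite lee_fin powR_ge0.
  - apply/measurable_EFinP; apply: measurable_fun_powR.
    by apply: measurable_funD; exact: measurable_fun_powR.
  - by apply: emeasurable_funD; apply/measurable_EFinP; exact: measurable_fun_powR.
  move=> x _; rewrite -EFinD lee_fin.
  apply: le_trans (powRD_le _ _ _ _) _; rewrite ?powR_ge0 ?divr_gt0//.
    by rewrite ler_pdivrMr// mul1r.
  by rewrite -!powRrM mulrC divfK// gt_eqF.
have ps1 : 1 <= p / s by rewrite ler_pdivlMr// mul1r ltW.
have ps0 : p / s != 0 by rewrite gt_eqF// divr_gt0.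
have nE (H : T -> R) (h : R) : (forall x, 0 <= H x) -> 0 <= h ->
    (\int[mu]_x (H x `^ p)%:E = (h `^ p)%:E)%E ->
    ('N[mu]_((p / s)%:E)[EFin \o (fun x => H x `^ s)%R] = (h `^ s)%:E)%E.
  move=> H0 h0 iH; rewrite Lnorm.unlock/=.
  under eq_integral => x _.
    rewrite ger0_norm ?powR_ge0// -powRrM (_ : s * (p / s) = p); last first.
      by rewrite mulrC divfK// gt_eqF.
    over.
  rewrite iH poweR_EFin -powRrM; congr (_ `^ _)%:E.
  by field; rewrite !gt_eqF.
have := eminkowski mu (measurable_fun_powR s mF) (measurable_fun_powR s mG)
  (ps1 : (1 <= (p / s)%:E)%E).
rewrite (nE F a)// (nE G b)// -EFinD.
move=> /(@gt0_ler_poweR _ (p / s) (le_trans ler01 ps1)).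
rewrite !in_itv/= !leey !andbT lee_fin Lnorm_ge0 addr_ge0 ?powR_ge0//.
move=> /(_ isT isT); rewrite (powR_Lnorm _ _ ps0).
apply: le_trans; rewrite le_eqVlt; apply/orP; left; apply/eqP.
apply: eq_integral => x _ /=.
by rewrite ger0_norm// addr_ge0// powR_ge0.
Qed.

Lemma cLnorm_EFin p (f : T -> R[i]) : 1 <= p ->
  cLnorm mu p%:E f = ((\int[mu]_x (cabs (f x) `^ p)%:E) `^ p^-1)%E.
Proof.
move=> p1; rewrite /cLnorm Lnorm.unlock.
apply: (congr1 (fun i => (i `^ p^-1)%E)).
by apply: eq_integral => x _ /=; rewrite ger0_norm// cabs_ge0.
Qed.

Lemma integral_cabs_powR p (f : T -> R[i]) : 1 <= p ->
  (cLnorm mu p%:E f < +oo)%E ->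
  (\int[mu]_x (cabs (f x) `^ p)%:E = (fine (cLnorm mu p%:E f) `^ p)%:E)%E.
Proof.
move=> p1; have pn0 : p != 0 by rewrite gt_eqF//; lra.
rewrite cLnorm_EFin//; set I := (\int[mu]_x _)%E => Ioo.
have I0 : (0 <= I)%E by apply: integral_ge0 => x _; rewrite lee_fin powR_ge0.
rewrite fine_poweR -powRrM mulVf// powRr1 ?fine_ge0// fineK//.
rewrite ge0_fin_numE//; move: Ioo; rewrite !ltey; apply: contra => /eqP ->.
by rewrite poweRyr// invr_eq0.
Qed.

(** The scalar inequality raised to the power p/q, the form in which it is integrated; note that
    (q-1) p/q = p/q'. *)
Lemma clarkson_complex_powR p q (z w : R[i]) : 0 < p -> 2 <= q ->
  (cabs (z + w) `^ q + cabs (z - w) `^ q) `^ (p / q) <=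
  2 `^ (p / q) *
    (cabs z `^ (q / (q - 1)) + cabs w `^ (q / (q - 1))) `^ (p / (q / (q - 1))).
Proof.
move=> p0 q2; have := @clarkson_complex _ q z w q2.
have q0 : 0 < q by lra.
have := addr_ge0 (powR_ge0 (cabs (z + w)) q) (powR_ge0 (cabs (z - w)) q).
have := addr_ge0 (powR_ge0 (cabs z) (q / (q - 1))) (powR_ge0 (cabs w) (q / (q - 1))).
set B := _ + cabs w `^ _; set A := _ + cabs (z - w) `^ q.
clearbody A B => B0 A0 AB.
rewrite (_ : p / (q / (q - 1)) = (q - 1) * (p / q)); last first.
  by field; rewrite !gt_eqF//; lra.
rewrite (powRrM B) -powRM ?powR_ge0//.
apply: ge0_ler_powR => //; first by apply: divr_ge0; exact: ltW.
by rewrite nnegrE mulr_ge0// powR_ge0.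
Qed.

(** Minkowski's inequality on pairs, with exponent q/p, is applied to |f + g|^p and |f - g|^p; the
    scalar inequality bounds the integrand, and [integral_sum_powR] with s = q' bounds its
    integral. *)
Lemma cLnorm_clarkson p q (f g : T -> R[i]) :
  1 <= p -> p <= q -> 2 <= q -> cmeasurable f -> cmeasurable g ->
  (cLnorm mu p%:E f < +oo)%E -> (cLnorm mu p%:E g < +oo)%E ->
  fine (cLnorm mu p%:E (f + g)) `^ q + fine (cLnorm mu p%:E (f - g)) `^ q <=
  2 * (fine (cLnorm mu p%:E f) `^ Num.min p (q / (q - 1)) +
       fine (cLnorm mu p%:E g) `^ Num.min p (q / (q - 1)))
     `^ (q / Num.min p (q / (q - 1))).
Proof.
move=> p1 pq q2 mf mg nf ng; set r := Num.min _ _.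
pose N h := fine (cLnorm mu p%:E h); rewrite -!/(N _).
have p0 : 0 < p by lra.
have q0 : 0 < q by lra.
have N0 h : 0 <= N h by rewrite fine_ge0// Lnorm_ge0.
have s0 : 0 < q / (q - 1) by rewrite divr_gt0//; lra.
have mD := cmeasurableD mf mg.
have gN : - g = (-1) *: g by rewrite scaleN1r.
have mNg : cmeasurable (- g) by rewrite gN; exact: cmeasurableZ.
have nNg : (cLnorm mu p%:E (- g)%R < +oo)%E.
  by rewrite gN (cLnormZ (p1 : (1 <= p%:E)%E))// lte_mul_pinfty ?lee_fin ?cabs_ge0.
have mB := cmeasurableD mf mNg.
have nD : (cLnorm mu p%:E (f + g)%R < +oo)%E.
  by rewrite (le_lt_trans (cLnormD mu (p1 : (1 <= p%:E)%E) mf mg))// lte_add_pinfty.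
have nB : (cLnorm mu p%:E (f - g)%R < +oo)%E.
  by rewrite (le_lt_trans (cLnormD mu (p1 : (1 <= p%:E)%E) mf mNg))// lte_add_pinfty.
have mc (h : T -> R[i]) : cmeasurable h ->
  measurable_fun [set: T] (fun x => cabs (h x)) by exact: cmeasurable_cabs.
have qp1 : 1 <= q / p by rewrite ler_pdivlMr// mul1r.
pose s := q / (q - 1).
(* Chosen so that W^(q/p) is the right-hand side of the claim. *)
pose W := 2 `^ (p / q) * (N f `^ r + N g `^ r) `^ (p / r).
have W0 : 0 <= W by rewrite mulr_ge0 ?powR_ge0.
have := @integral_pair_powR (fun x => cabs ((f + g) x) `^ p)
  (fun x => cabs ((f - g) x) `^ p) (N (f + g) `^ p) (N (f - g) `^ p) W (q / p) qp1
  (measurable_fun_powR _ (mc _ mD)) (measurable_fun_powR _ (mc _ mB))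
  (fun=> powR_ge0 _ _) (fun=> powR_ge0 _ _) (powR_ge0 _ _) (powR_ge0 _ _)
  (integral_cabs_powR p1 nD) (integral_cabs_powR p1 nB).
have epq u : (u `^ p) `^ (q / p) = u `^ q :> R.
  by rewrite -powRrM mulrC divfK// gt_eqF.
rewrite !epq => H; apply: le_trans (H _) _; last first.
  rewrite powRM ?powR_ge0// -!powRrM.
  rewrite (_ : p / q * (q / p) = 1) ?powRr1//; last by field; rewrite !gt_eqF.
  rewrite (_ : p / r * (q / p) = q / r)//.
  by field; rewrite !gt_eqF// lt_min p0.
apply: (@le_trans _ _
  (\int[mu]_x ((2 `^ (p / q))%:E * ((cabs (f x) `^ s + cabs (g x) `^ s) `^ (p / s))%:E))%E).
  apply: ge0_le_integral; first exact: measurableT.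
  - by move=> x _; rewrite lee_fin powR_ge0.
  - apply/measurable_EFinP; apply: measurable_fun_powR; apply: measurable_funD;
      by do 2![apply: measurable_fun_powR]; exact: mc.
  - apply/measurable_EFinP; apply: measurable_funM => //.
    by apply: measurable_fun_powR; apply: measurable_funD;
      apply: measurable_fun_powR; exact: mc.
  move=> x _; rewrite -EFinM lee_fin !epq invf_div.
  exact: clarkson_complex_powR.
rewrite ge0_integralZl_EFin ?powR_ge0//; last 2 first.
  by move=> x _; rewrite lee_fin powR_ge0.
  apply/measurable_EFinP; apply: measurable_fun_powR; apply: measurable_funD;
    by apply: measurable_fun_powR; exact: mc.
rewrite EFinM lee_wpmul2l ?lee_fin ?powR_ge0//.
apply: integral_sum_powR; rewrite ?N0//; try exact: mc; try by move=> x; exact: cabs_ge0.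
- exact: integral_cabs_powR.
- exact: integral_cabs_powR.
Qed.

End Lp_inequalities.

(** * Symmetric multilinear forms on sequences *)

Section seq_form.
Variables (R : realType) (X : normedModType R[i]) (m : nat).
Variable L : ('I_m -> X) -> R[i].
Hypotheses (Lmul : multilinear L) (Lsym : Defs.symmetric_form L).
Implicit Types (s t : seq X) (u v x y : X).

(* [L] is evaluated on sequences of size [m], for which symmetry becomes
   invariance under [perm_eq]; shorter sequences are padded with [0]. *)
Definition seq_fun s : 'I_m -> X := fun i => nth 0 s i.

Definition seq_form s : R[i] := L (seq_fun s).

Lemma seq_form_perm s t : size t = m -> perm_eq s t ->
  seq_form s = seq_form t.
Proof.
move=> tm; have tP : size t == m by rewrite tm.
move=> /(@tuple_permP _ _ _ (Tuple tP))[p ->].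
rewrite /seq_form -[RHS](Lsym p); congr L; apply/funext => i /=.
by rewrite /seq_fun nth_mktuple (tnth_nth 0).
Qed.

Lemma seq_formD a u v s : (size s).+1 = m ->
  seq_form (a *: u + v :: s) = a * seq_form (u :: s) + seq_form (v :: s).
Proof.
move=> sm; have m0 : (0 < m)%N by rewrite -sm.
pose i0 := Ordinal m0.
have E w : seq_fun (w :: s) = dfwith (seq_fun (0 :: s)) i0 w.
  apply/funext => i; have [->|ii0] := eqVneq i i0; first by rewrite dfwithin.
  by rewrite dfwithout 1?eq_sym//; case: i ii0 => [[|i] im] //; rewrite -val_eqE.
rewrite /seq_form (E (a *: u + v)) (E u) (E v); exact: Lmul.
Qed.

Lemma seq_form0 s : (size s).+1 = m -> seq_form (0 :: s) = 0.
Proof.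
move=> sm; have := seq_formD 1 0 0 sm; rewrite scaler0 addr0 mul1r.
by move/eqP; rewrite -subr_eq subrr eq_sym => /eqP.
Qed.

Lemma seq_formZ a u s : (size s).+1 = m ->
  seq_form (a *: u :: s) = a * seq_form (u :: s).
Proof. by move=> sm; rewrite -[a *: u]addr0 seq_formD// seq_form0// addr0. Qed.

Lemma seq_form_nseqZ a u s n : (n + size s)%N = m ->
  seq_form (nseq n (a *: u) ++ s) = a ^+ n * seq_form (nseq n u ++ s).
Proof.
elim: n s => [|n IH] s sm; first by rewrite expr0 mul1r.
rewrite [nseq _ _ ++ _]/= seq_formZ; last by rewrite size_cat size_nseq -sm.
have nm : (n + size (u :: s))%N = m by rewrite /= addnS -addSn.
rewrite (@seq_form_perm _ (nseq n (a *: u) ++ u :: s)); last 2 first.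
- by rewrite size_cat size_nseq.
- by rewrite -cat_rcons -cat1s perm_catCA -cats1 -catA.
rewrite IH// exprS mulrA; congr (_ * _); apply: seq_form_perm.
  by rewrite size_cat size_nseq.
by rewrite -[u :: s]cat1s perm_catCA.
Qed.

Lemma seq_form_nseq2Z (a b : R[i]) x y j i : (j + i)%N = m ->
  seq_form (nseq j (b *: y) ++ nseq i (a *: x)) =
  (a ^+ i * b ^+ j) * seq_form (nseq j y ++ nseq i x).
Proof.
move=> jim.
rewrite seq_form_nseqZ ?size_nseq//.
rewrite (@seq_form_perm _ (nseq i (a *: x) ++ nseq j y)); last 2 first.
- by rewrite size_cat !size_nseq addnC.
- by rewrite perm_catC.
rewrite seq_form_nseqZ ?size_nseq 1?addnC//.
rewrite (@seq_form_perm _ (nseq j y ++ nseq i x)); last 2 first.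
- by rewrite size_cat !size_nseq.
- by rewrite perm_catC.
by rewrite mulrA [a ^+ i * _]mulrC.
Qed.

(** Induction on [n]: linearity splits one copy of u + v, the chosen vector joins [s], and Pascal's
    rule merges the two resulting sums. *)
Lemma seq_form_binomial u v n s : (size s + n)%N = m ->
  seq_form (s ++ nseq n (u + v)) =
  \sum_(j < n.+1) 'C(n, j)%:R * seq_form (s ++ nseq j v ++ nseq (n - j) u).
Proof.
elim: n s => [|n IH] s sm; first by rewrite big_ord1 bin0 mul1r.
have sn : size (s ++ nseq n (u + v)) = (size s + n)%N by rewrite size_cat size_nseq.
rewrite (@seq_form_perm _ (u + v :: (s ++ nseq n (u + v)))); last 2 first.
- by rewrite /= sn -addnS.
- by rewrite [nseq n.+1 _]/= -cat1s perm_catCA.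
rewrite -[u in u + v :: _]scale1r seq_formD ?mul1r; last by rewrite sn -addnS.
rewrite -!cat_cons !IH/= ?addSnnS//.
pose g j i := seq_form (s ++ nseq j v ++ nseq i u).
have gu (j : 'I_n.+1) : seq_form (u :: s ++ nseq j v ++ nseq (n - j) u) = g j (n.+1 - j)%N.
  apply: seq_form_perm.
    by rewrite !size_cat !size_nseq subnKC ?sm// ltnW.
  rewrite subSn ?leq_ord//= -cat1s perm_catCA perm_cat2l.
  by rewrite -[u :: nseq _ _]cat1s perm_catCA.
have gv (j : 'I_n.+1) : seq_form (v :: s ++ nseq j v ++ nseq (n - j) u) = g j.+1 (n - j)%N.
  apply: seq_form_perm.
    by rewrite !size_cat !size_nseq -subSS subnKC ?sm.
  by rewrite -cat1s perm_catCA.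
under eq_bigr => j _ do rewrite gu.
under [X in _ + X]eq_bigr => j _ do rewrite gv.
rewrite big_ord_recl [X in _ + X]big_ord_recr/= [RHS]big_ord_recl [in RHS]big_ord_recr/=.
rewrite !bin0 !binn -!addrA; congr (_ + _); rewrite addrA; congr (_ + _).
  rewrite -big_split/=; apply: eq_bigr => i _.
  by rewrite /bump !add1n binS natrD mulrDl subSS.
Qed.

Lemma seq_form_diag_binomial x y (a b : R[i]) :
  L (fun=> a *: x + b *: y) = \sum_(j < m.+1)
    'C(m, j)%:R * (a ^+ (m - j) * b ^+ j) *
      seq_form (nseq j y ++ nseq (m - j) x).
Proof.
have -> : (fun=> a *: x + b *: y) = seq_fun (nseq m (a *: x + b *: y)).
  by apply/funext => i; rewrite /seq_fun nth_nseq ltn_ord.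
rewrite -/(seq_form _) -[nseq m _]cat0s seq_form_binomial//; apply: eq_bigr => j _.
have jm : (j <= m)%N by rewrite -ltnS.
by rewrite seq_form_nseq2Z ?subnKC// mulrA.
Qed.

(** Discrete Fourier inversion: the weight z^(i(N-k)) acts as z^(-ik), and since all degrees j <= m
    are below N, only j = k survives the sum over the N-th roots of unity. *)
Lemma seq_form_extract x y N (z : R[i]) k : N.-primitive_root z ->
  (m < N)%N -> (k <= m)%N ->
  \sum_(i < N) (z ^+ i) ^+ (N - k) * L (fun=> x + z ^+ i *: y) =
  N%:R * ('C(m, k)%:R * seq_form (nseq k y ++ nseq (m - k) x)).
Proof.
move=> zN mN km.
have kN : (k < N)%N by exact: leq_ltn_trans mN.
have E (i : 'I_N) : (z ^+ i) ^+ (N - k) * L (fun=> x + z ^+ i *: y) =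
    \sum_(j < m.+1) (z ^+ (N - k + j)) ^+ i *
      ('C(m, j)%:R * seq_form (nseq j y ++ nseq (m - j) x)).
  rewrite -[x in X in L X]scale1r seq_form_diag_binomial big_distrr/=.
  apply: eq_bigr => j _; rewrite expr1n mul1r -!exprM mulnDl exprD.
  rewrite [(i * _)%N]mulnC [(i * j)%N]mulnC.
  by rewrite !mulrA; congr (_ * _); rewrite -!mulrA; congr (_ * _); rewrite mulrC.
under eq_bigr => i _ do rewrite E.
rewrite exchange_big/=.
under eq_bigr => j _ do rewrite -big_distrl/=.
have km1 : (k < m.+1)%N by [].
rewrite (bigD1 (Ordinal km1))//= subnK ?(ltnW kN)// (prim_expr_order zN).
under [X in X * _ + _]eq_bigr => i _ do rewrite expr1n.
rewrite sumr_const card_ord big1 ?addr0// => j jk.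
have jN : (j < N)%N by rewrite (leq_ltn_trans _ mN)// -ltnS.
set w := z ^+ _.
(* If w = 1 then N divides N + j - k; as j, k < N, the quotient can only be 1, which means j = k. *)
have w1 : w != 1.
  rewrite /w -(prim_order_dvd zN); apply/negP => /dvdnP[c hc].
  have {hc} : (N + j = c * N + k)%N by rewrite -hc addnAC subnK ?(ltnW kN)// addnC.
  move: c => [|[|c]]; rewrite ?mul0n ?mul1n ?add0n.
  - by move=> h; move: kN; rewrite -h ltnNge leq_addr.
  - by move/addnI => h; move: jk; rewrite -val_eqE/= h eqxx.
  - move=> h; have : (N + j < N + N)%N by rewrite ltn_add2l.
    by rewrite h !mulSn addnA -!addnA ltn_add2l -[X in (_ < X)%N]addn0 ltn_add2l.
(* Since w^N = 1 and w differs from 1, the geometric sum vanishes. *)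
have /eqP := subrX1 w N.
rewrite {1}/w exprAC (prim_expr_order zN) expr1n subrr eq_sym mulf_eq0.
by rewrite subr_eq0 (negbTE w1)/= => /eqP ->; rewrite mul0r.
Qed.

End seq_form.

(** X^n - 1 is separable, hence has n distinct roots, and n distinct n-th roots of unity include a
    primitive one. *)
Lemma prim_root_exists (C : numClosedFieldType) n : (0 < n)%N ->
  exists z : C, n.-primitive_root z.
Proof.
move=> n0; pose p : {poly C} := 'X^n - 1.
have [r Dp] := closed_field_poly_normal p.
rewrite (monicP _) ?monicXnsubC// scale1r in Dp.
have rn1 : all n.-unity_root r.
  by apply/allP => z; rewrite -root_prod_XsubC -Dp.
have szr : (n < (size r).+1)%N.
  by rewrite -(size_prod_XsubC r id) -Dp size_XnsubC.
have [|z _ zn] := hasP (has_prim_root n0 rn1 _ szr); last by exists z.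
by rewrite -separable_prod_XsubC -Dp separable_Xn_sub_1// pnatr_eq0 -lt0n.
Qed.

(** * The norm as a real number *)

Section real_norm.
Variables (R : realType) (X : normedModType R[i]).
Implicit Types x y : X.

(** The norm of [X] takes values in [R[i]], whereas real powers need an element of [R]. *)
Definition rnorm x : R := complex.Re `|x|.

Lemma ltr0_realc (a : R) : (0 < a%:C) = (0 < a).
Proof. exact: (ltcR 0 a). Qed.

Lemma rnormE x : (rnorm x)%:C = `|x|.
Proof. by rewrite /rnorm RRe_real// normr_real. Qed.

Lemma rnorm_ge0 x : 0 <= rnorm x.
Proof. by rewrite -ler0c rnormE. Qed.

Lemma rnorm0 : rnorm 0 = 0.
Proof. by rewrite /rnorm normr0. Qed.

Lemma rnormD x y : rnorm (x + y) <= rnorm x + rnorm y.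
Proof. by rewrite -lecR rmorphD/= !rnormE ler_normD. Qed.

Lemma rnormZ (a : R[i]) x : rnorm (a *: x) = cabs a * rnorm x.
Proof. by apply: complexI; rewrite rmorphM/= cabsE !rnormE normrZ. Qed.

Lemma rnorm_gt0 x : x != 0 -> 0 < rnorm x.
Proof. by move=> x0; rewrite -ltr0_realc rnormE normr_gt0. Qed.

Lemma rnorm_le1 x : (`|x| <= 1) = (rnorm x <= 1).
Proof. by rewrite -rnormE -lecR. Qed.

Lemma near0_rnorm_le (e : R) : 0 < e -> \forall h \near (0 : X), rnorm h <= e.
Proof.
move=> e0; have e0' : 0 < e%:C by rewrite ltr0_realc.
by apply: filterS (nbhs0_le e0') => h; rewrite -rnormE lecR.
Qed.

Lemma near0_rnorm (P : X -> Prop) : (\forall h \near (0 : X), P h) ->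
  exists2 e : R, 0 < e & forall h, rnorm h <= e -> P h.
Proof.
move=> /nbhs_norm0P[e /= e0 eP].
have eE : e = (complex.Re e)%:C by rewrite RRe_real// gtr0_real.
have re0 : 0 < complex.Re e by rewrite -ltr0_realc -eE.
(* Half the radius leaves room for the strict inequality that defines the ball. *)
exists (complex.Re e / 2); first exact: divr_gt0.
move=> h he; apply: eP => /=; rewrite eE -rnormE ltcR.
by rewrite (le_lt_trans he)// ltr_pdivrMr// mulr_natr mulr2n ltrDl.
Qed.

Lemma cabs_real (a : R) : 0 <= a -> cabs (a%:C : R[i]) = a.
Proof. by move=> a0; apply: complexI; rewrite cabsE ger0_norm// ler0c. Qed.

Lemma cabs_sum (I : Type) (r : seq I) (P : pred I) (F : I -> R[i]) :
  cabs (\sum_(i <- r | P i) F i) <= \sum_(i <- r | P i) cabs (F i).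
Proof.
elim/big_ind2: _ => // [|a b c d ab cd]; first by rewrite /cabs normr0.
by apply: le_trans (cabsD _ _) _; exact: lerD.
Qed.

Lemma cabsX (a : R[i]) n : cabs (a ^+ n) = cabs a ^+ n.
Proof. by apply: complexI; rewrite rmorphXn/= !cabsE normrX. Qed.

Lemma cabs_nat n : cabs (n%:R : R[i]) = n%:R.
Proof. by apply: complexI; rewrite cabsE normr_nat rmorph_nat. Qed.

Lemma poly_norm_ge0 (P : X -> R[i]) : (0 <= poly_norm P)%E.
Proof.
apply: le_trans (_ : (cabs (P 0))%:E <= _)%E; first by rewrite lee_fin cabs_ge0.
by apply: ereal_sup_ubound; exists 0; rewrite //= normr0.
Qed.

End real_norm.

(** * Pointwise convergence and continuity of forms *)

Section pointwise_topology.
Variables (n : nat) (V : topologicalType).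

(** The pointwise topology is the supremum of the topologies pulled back along the coordinates, so
    convergence is tested on each of them. *)
Lemma ptws_cvgP (F : set_system ('I_n -> V)) (f : 'I_n -> V) : Filter F ->
  (forall i, (fun g => g i) @ F --> f i) -> {ptws, F --> f}.
Proof.
move=> FF Ff; apply/cvg_sup => i.
apply/cvg_image; first by rewrite eqEsubset; split=> v // _; exists (cst v).
move=> W /(Ff i) WF; exists ((fun g => g i) @^-1` W) => //.
by rewrite eqEsubset; split => [j [? + <-//]|j Wj]; exists (fun=> j).
Qed.

End pointwise_topology.

Section continuous_seq_form.
Variables (R : realType) (X : normedModType R[i]) (m : nat).
Variable L : ('I_m -> X) -> R[i].
Hypothesis Lcont : continuous_form L.

(** The filter generated by the cubes U^m converges pointwise to 0, so |L y - L 0| < 1 on a whole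
    cube, and K = 1 + |L 0| serves. *)
Lemma continuous_form_bounded0 : exists (e K : R),
  [/\ 0 < e, 0 <= K & forall y, (forall i, rnorm (y i) <= e) -> cabs (L y) <= K].
Proof.
pose F : set_system ('I_m -> X) :=
  filter_from (nbhs (0 : X)) (fun U => [set y | forall i, U (y i)]).
have FF : Filter F.
  apply: filter_from_filter; first by exists setT; exact: filterT.
  move=> U V U0 V0; exists (U `&` V); first exact: filterI.
  by move=> y Uy; split => i; case: (Uy i).
have F0 : {ptws, F --> (fun=> 0 : X)}.
  by apply: ptws_cvgP => i U U0; exists U => // y /(_ i).
have LF : (L @ F) --> (L (fun=> 0) : R[i]^o).
  move=> W W0; apply: F0.
  exact: (@Lcont (fun=> 0) W W0).
have := (pseudometric_normed_Zmodule.cvgrPdist_lt (V := R[i]^o) L (L (fun=> 0))).1 LF 1 ltr01.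
move=> [U /near0_rnorm[e e0 eU] UL].
exists e, (1 + cabs (L (fun=> 0))); split => //.
  by rewrite addr_ge0// cabs_ge0.
move=> y ye; have := UL y (fun i => eU _ (ye i)).
rewrite /= -cabsE (ltcR _ 1) => h.
have := cabsB_le (L y) (L (fun=> 0)).
rewrite -(cabsN (L y - _)) opprB lerBlDr => /le_trans; apply.
by rewrite lerD2r ltW.
Qed.

(** Each slot of the sequence is either a coordinate of [y] or a fixed vector, so the sequence
    depends continuously on [y]. *)
Lemma continuous_seq_form k (t : seq X) :
  continuous_form (fun y : 'I_k -> X => L (seq_fun (codom y ++ t))).
Proof.
move=> y.
have sF : {ptws, (fun z : 'I_k -> X => seq_fun (codom z ++ t) : 'I_m -> X) @
    nbhs (y : {ptws 'I_k -> X}) --> (seq_fun (codom y ++ t) : 'I_m -> X)}.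
  apply: ptws_cvgP => i W.
  have [ik|ki] := ltnP i k.
    have E (z : 'I_k -> X) : seq_fun (codom z ++ t) i = z (Ordinal ik).
      rewrite /seq_fun nth_cat size_codom card_ord ik codomE (nth_map (Ordinal ik)).
        by congr z; apply: val_inj; rewrite /= nth_enum_ord.
      by rewrite size_enum_ord.
    rewrite E => Wy.
    have yW : nbhs (y : {ptws 'I_k -> X}) [set z | W (z (Ordinal ik))] :=
      @proj_continuous 'I_k (fun=> X) (Ordinal ik) y W Wy.
    have sub : [set z : 'I_k -> X | W (z (Ordinal ik))] `<=`
      [set z | W (seq_fun (codom z ++ t) i)] by move=> z; rewrite /mkset E.
    exact: (@filterS _ (nbhs (y : {ptws 'I_k -> X})) _ _ _ sub yW).
  have E (z : 'I_k -> X) : seq_fun (codom z ++ t) i = nth 0 t (i - k).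
    by rewrite /seq_fun nth_cat size_codom card_ord ltnNge ki.
  rewrite E => Wy.
  have sub : forall z : 'I_k -> X, W (seq_fun (codom z ++ t) i).
    by move=> z; rewrite E; exact: nbhs_singleton.
  have yW := @filterE _ (nbhs (y : {ptws 'I_k -> X})) _ _ sub.
  exact: yW.
move=> W Wy; have LW := @Lcont _ W Wy.
exact: (@sF _ LW).
Qed.

End continuous_seq_form.

(** * Frechet derivatives of homogeneous polynomials *)

Section frechet.
Variables (R : realType) (X : normedModType R[i]) (m : nat).
Variable L : ('I_m -> X) -> R[i].
Hypotheses (Lmul : multilinear L) (Lsym : Defs.symmetric_form L).
Hypothesis Lcont : continuous_form L.
Implicit Types (s t : seq X) (x h : X).

(** Rescaling each vector to norm [e] turns the bound on a cube into a bound by the product of the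
    norms. *)
Lemma seq_form_bounded : exists2 K : R, 0 <= K & forall s, size s = m ->
  cabs (seq_form L s) <= K * \prod_(z <- s) rnorm z.
Proof.
have [e [K [e0 K0 LK]]] := continuous_form_bounded0 Lcont.
(* Vectors of [s] await rescaling, those of [t] have norm at most [e]; the induction moves one
   vector from [s] to [t]. *)
have claim s : forall t, (size s + size t)%N = m ->
    (forall z, z \in t -> rnorm z <= e) ->
    cabs (seq_form L (s ++ t)) <= K * \prod_(z <- s) (rnorm z / e).
  elim: s => [|z s IH] t st te.
    rewrite big_nil mulr1; apply: LK => i; rewrite /seq_fun.
    by apply: te; rewrite mem_nth// (_ : size t = m).
  (* A zero vector cannot be rescaled, but it makes the form vanish. *)
  have [->|z0] := eqVneq z 0.
    rewrite cat_cons seq_form0 ?size_cat// big_cons rnorm0 !mul0r mulr0.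
    by rewrite /cabs normr0.
  have rz0 := rnorm_gt0 z0.
  pose w := (e / rnorm z)%:C *: z.
  have we : rnorm w = e.
    by rewrite rnormZ cabs_real ?divr_ge0 ?ltW// divfK// gt_eqF.
  have zE : z = (rnorm z / e)%:C *: w.
    rewrite scalerA -rmorphM/= mulrA divfK ?gt_eqF// divff ?gt_eqF//.
    by rewrite scale1r.
  have swt : perm_eq (w :: s ++ t) (s ++ w :: t).
    by rewrite -[w :: t]cat1s -cat1s perm_catCA.
  rewrite cat_cons {1}zE (seq_formZ Lmul) ?size_cat// cabsM.
  rewrite cabs_real ?divr_ge0 ?(ltW e0) ?(ltW rz0)// big_cons mulrCA.
  rewrite ler_pM2l ?divr_gt0//.
  have st' : (size s + size (w :: t))%N = m by rewrite /= addnS.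
  rewrite (seq_form_perm Lsym _ swt) ?size_cat//; apply: IH => // u.
  by rewrite inE => /predU1P[->|/te//]; rewrite we.
exists (K * e^-1 ^+ m) => [|s sm].
  by rewrite mulr_ge0// exprn_ge0// invr_ge0 ltW.
have := claim s [::]; rewrite cats0 addn0 => /(_ sm) /(_ _)/le_trans; apply => //.
rewrite -mulrA; apply: ler_wpM2l => //.
by rewrite big_split/= [X in _ * X <= _]big_const_seq count_predT sm -Monoid.iteropE/= mulrC.
Qed.

Lemma codom_fcons k h (y : 'I_k -> X) : codom (fcons h y) = h :: codom y.
Proof.
rewrite !codomE enum_ordSl /= {1}/fcons unlift_none -map_comp; congr (_ :: _).
by apply: eq_map => i /=; rewrite /fcons liftK.
Qed.

Lemma seq_fun_codom k t (y : 'I_k -> X) (i : 'I_m) (ik : (i < k)%N) :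
  seq_fun (codom y ++ t) i = y (Ordinal ik).
Proof.
rewrite /seq_fun nth_cat size_codom card_ord ik codomE (nth_map (Ordinal ik)).
  by congr y; apply: val_inj; rewrite /= nth_enum_ord.
by rewrite size_enum_ord.
Qed.

(** The candidate for the k-th derivative: the falling factorial equals k! C(m, k), the directions
    fill the first k slots and [x] the others. *)
Definition poly_derivative k x (y : 'I_k -> X) : R[i] :=
  (m ^_ k)%:R * seq_form L (codom y ++ nseq (m - k) x).

Lemma poly_derivative_multilinear k x : (k <= m)%N ->
  multilinear (@poly_derivative k x).
Proof.
move=> km i y a u v; rewrite /poly_derivative.
set t := nseq _ _.
have E w : seq_fun (codom (dfwith y i w) ++ t) =
    dfwith (seq_fun (codom y ++ t)) (widen_ord km i) w.
  apply/funext => j; have [->|ji] := eqVneq j (widen_ord km i).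
    rewrite dfwithin (@seq_fun_codom k t _ (widen_ord km i) (ltn_ord i)).
    by rewrite (_ : Ordinal _ = i) ?dfwithin//; exact: val_inj.
  rewrite dfwithout 1?eq_sym//.
  have [jk|kj] := ltnP j k.
    rewrite !(@seq_fun_codom _ _ _ _ jk) dfwithout// eq_sym.
    by apply: contra ji => /eqP <-; apply/eqP/val_inj.
  by rewrite /seq_fun !nth_cat !size_codom card_ord ltnNge kj.
rewrite /seq_form !E Lmul mulrDr; congr (_ + _).
by rewrite mulrCA.
Qed.

Lemma poly_derivative_continuous k x : continuous_form (@poly_derivative k x).
Proof.
move=> y.
have := @continuous_seq_form _ _ _ _ Lcont k (nseq (m - k) x) y.
move=> Ly; apply: (cvgM (cvg_cst _) Ly).
Qed.

(** In the binomial expansion at x + h the term j = 0 is the value at [x] and j = 1 is the next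
    derivative; every other term contains [h] at least twice. *)
Lemma poly_derivative_remainder k x (K : R) : (k < m)%N ->
  (forall s, size s = m -> cabs (seq_form L s) <= K * \prod_(z <- s) rnorm z) ->
  0 <= K ->
  forall (h : X) (y : 'I_k -> X), rnorm h <= 1 -> (forall i, rnorm (y i) <= 1) ->
  cabs (poly_derivative (x + h) y - poly_derivative x y -
        poly_derivative x (fcons h y)) <=
  (m ^_ k)%:R * (2 ^ (m - k))%:R * (K * (1 + rnorm x) ^+ m) * rnorm h ^+ 2.
Proof.
move=> km LK K0 h y h1 y1.
set s := codom y.
have ss : size s = k by rewrite size_codom card_ord.
pose n := (m - k.+1)%N.
have nE : (m - k)%N = n.+1 by rewrite /n subnSK.
have sn : (size s + n.+1)%N = m by rewrite ss -nE subnKC// ltnW.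
rewrite /poly_derivative codom_fcons -/s nE (seq_form_binomial Lmul Lsym)//.
pose g j := 'C(n.+1, j)%:R * seq_form L (s ++ nseq j h ++ nseq (n.+1 - j) x).
rewrite -[\sum_(j < n.+2) _]/(\sum_(j < n.+2) g j) big_ord_recl big_ord_recl.
have g0 : g 0%N = seq_form L (s ++ nseq n.+1 x).
  by rewrite /g bin0 mul1r.
have g1 : g 1%N = n.+1%:R * seq_form L ((h :: s) ++ nseq n x).
  rewrite /g bin1 subSS subn0; congr (_ * _).
  apply: (seq_form_perm Lsym); first by rewrite /= size_cat size_nseq -addnS.
  by rewrite -[(h :: s) ++ _]cat1s perm_catCA.
rewrite (g0 : g ord0 = _) (g1 : g (lift ord0 ord0) = _).
have algE (c N A B S : R[i]) : c * (A + (N * B + S)) - c * A - c * N * B = c * S.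
  by ring.
(* The falling factorial gains the factor m - k = n + 1, which is the binomial coefficient of the
   term j = 1. *)
rewrite ffactnSr nE natrM -/n algE.
rewrite cabsM cabs_nat -!mulrA ler_wpM2l ?ler0n//.
apply: le_trans (cabs_sum _ _ _) _.
have pn i (z : X) : \prod_(u <- nseq i z) rnorm u = rnorm z ^+ i.
  by elim: i => [|i IH]; rewrite ?big_nil// big_cons IH exprS.
have b (j : 'I_n) : cabs (g (lift ord0 (lift ord0 j))) <=
    'C(n.+1, j.+2)%:R * ((K * (1 + rnorm x) ^+ m) * rnorm h ^+ 2).
  rewrite -[g _]/(g j.+2) /g cabsM cabs_nat ler_wpM2l ?ler0n//.
  have jn : (j.+2 <= n.+1)%N by rewrite ltnS.
  apply: le_trans (LK _ _) _; first by rewrite !size_cat !size_nseq subnKC.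
  rewrite -mulrA ler_wpM2l//.
  rewrite big_cat [X in _ * X <= _]big_cat !pn.
  have p1 : \prod_(z <- s) rnorm z <= 1.
    rewrite /s codomE big_map; apply: prodr_ile1 => i _.
    by rewrite rnorm_ge0 y1.
  have p10 : 0 <= \prod_(z <- s) rnorm z.
    by apply: prodr_ge0 => z _; exact: rnorm_ge0.
  rewrite -[leRHS]mul1r ler_pM//.
    by rewrite mulr_ge0 ?exprn_ge0 ?rnorm_ge0.
  rewrite mulrC ler_pM ?exprn_ge0 ?rnorm_ge0//.
    by rewrite -addn2 exprD ler_piMl ?exprn_ge0 ?rnorm_ge0// exprn_ile1 ?rnorm_ge0.
  apply: (@le_trans _ _ ((1 + rnorm x) ^+ (n.+1 - j.+2))).
    by rewrite lerXn2r// ?nnegrE ?addr_ge0 ?rnorm_ge0// lerDr.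
  apply: ler_weXn2l; first by rewrite lerDl rnorm_ge0.
  by rewrite -sn (leq_trans (leq_subr _ _))// leq_addl.
apply: le_trans (ler_sum _ (fun j _ => b j)) _.
rewrite [X in _ <= _ * X]mulrA -big_distrl/= ler_wpM2r//.
  by rewrite !mulr_ge0 ?exprn_ge0 ?addr_ge0 ?rnorm_ge0.
(* The remaining binomial coefficients are part of the expansion of (1 + 1)^(n+1). *)
rewrite -natr_sum ler_nat.
have := expnDn 1 1 n.+1; rewrite addn1 => ->.
rewrite 2!big_ord_recl addnA; apply: leq_trans (leq_addl _ _).
by apply: leq_sum => j _; rewrite !exp1n !muln1.
Qed.

Lemma poly_derivative_frechet k x : (k < m)%N ->
  is_frechet_derivative (@poly_derivative k) x (@poly_derivative k.+1 x).
Proof.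
move=> km; split.
- exact: poly_derivative_multilinear.
- exact: poly_derivative_continuous.
have [K K0 LK] := seq_form_bounded.
move=> e e0; have rem := poly_derivative_remainder x km LK K0.
pose C := (m ^_ k)%:R * (2 ^ (m - k))%:R * (K * (1 + rnorm x) ^+ m).
have C0 : 0 <= C.
  by rewrite !mulr_ge0 ?exprn_ge0 ?addr_ge0 ?rnorm_ge0.
have C1 : 0 < C + 1 by rewrite ltr_wpDl.
(* For |h| <= e/(C + 1) the remainder C |h|^2 is at most e |h|; the added 1 guards against C = 0. *)
have := near0_rnorm_le X (divr_gt0 e0 C1).
apply: filterS2 (near0_rnorm_le X ltr01) => h h1 he.
apply: ge_ereal_sup => _ [y /= y1 <-]; rewrite lee_fin.
apply: le_trans (rem h y h1 _) _ => [i|]; first by rewrite -rnorm_le1.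
rewrite -/C -[complex.Re `|h|]/(rnorm h) expr2 mulrA ler_wpM2r ?rnorm_ge0//.
apply: le_trans (_ : (C + 1) * rnorm h <= _).
  by rewrite ler_wpM2r ?rnorm_ge0// lerDl.
by rewrite mulrC -ler_pdivlMr.
Qed.

End frechet.

(** * Uniqueness of the derivative and its explicit formula *)

Section frechet_unique.
Variables (R : realType) (X : normedModType R[i]).

Lemma multilinearZ n (A : ('I_n -> X) -> R[i]) (c : R[i]) (y : 'I_n -> X) :
  multilinear A -> A (fun i => c *: y i) = c ^+ n * A y.
Proof.
move=> Amul.
have A0 (i : 'I_n) (z : 'I_n -> X) : A (dfwith z i 0) = 0.
  have := Amul i z 1 0 0; rewrite scaler0 addr0 mul1r => /eqP.
  by rewrite -subr_eq subrr eq_sym => /eqP.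
have AZ (i : 'I_n) (z : 'I_n -> X) (u : X) : A (dfwith z i (c *: u)) = c * A (dfwith z i u).
  by rewrite -[c *: u]addr0 Amul A0 addr0.
have step j : (j <= n)%N ->
    A (fun i => if (i < j)%N then c *: y i else y i) = c ^+ j * A y.
  elim: j => [|j IH] jn.
    by rewrite expr0 mul1r; congr A; apply/funext.
  pose z := fun i : 'I_n => if (i < j)%N then c *: y i else y i.
  have zj u : dfwith z (Ordinal jn) u = fun i => if i == Ordinal jn then u else z i.
    apply/funext => i; have [->|ij] := eqVneq i (Ordinal jn).
      by rewrite dfwithin.
    by rewrite dfwithout// eq_sym.
  have -> : (fun i : 'I_n => if (i < j.+1)%N then c *: y i else y i) =
      dfwith z (Ordinal jn) (c *: y (Ordinal jn)).
    rewrite zj; apply/funext => i; have [->|ij] := eqVneq i (Ordinal jn).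
      by rewrite /= ltnSn.
    by rewrite /z ltnS leq_eqVlt (_ : (_ == j :> nat) = false)//; apply/negbTE.
  rewrite AZ exprS -mulrA -IH 1?ltnW// zj; congr (_ * A _).
  apply/funext => i; have [->|//] := eqVneq i (Ordinal jn).
  by rewrite /z ltnn.
rewrite -step//; congr A; apply/funext => i.
by rewrite ltn_ord.
Qed.

(** Both forms approximate the same increment, so along h = c z_0 they differ by at most e c;
    linearity in [h] cancels c, and e is arbitrary. *)
Lemma is_frechet_derivative_unique n (G : X -> ('I_n -> X) -> R[i]) x A B :
  is_frechet_derivative G x A -> is_frechet_derivative G x B -> A = B.
Proof.
move=> [Amul _ AG] [Bmul _ BG].
have fconsE (z : 'I_n.+1 -> X) : z = fcons (z ord0) (fun i => z (lift ord0 i)).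
  apply/funext => i; rewrite /fcons; case: unliftP => [j ->|->] //=.
have key (z : 'I_n.+1 -> X) : (forall i, rnorm (z i) <= 1) -> A z = B z.
  move=> z1; apply/eqP; rewrite -subr_eq0; apply/eqP/cabs_eq0.
  apply/eqP; rewrite eq_le cabs_ge0 andbT; apply/ler_addgt0Pr => e e0.
  rewrite add0r.
  have e20 : 0 < e / 2 by exact: divr_gt0.
  have : \forall h \near (0 : X),
     (form_norm (fun y => (G (x + h) y - G x y - A (fcons h y))%R)
           <= ((e / 2) * complex.Re `|h|)%:E)%E /\
     (form_norm (fun y => (G (x + h) y - G x y - B (fcons h y))%R)
           <= ((e / 2) * complex.Re `|h|)%:E)%E.
    by apply: filterS2 (AG _ e20) (BG _ e20) => h ha hb; split.
  move=> /near0_rnorm[r r0 rP].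
  (* Small enough for both approximations to hold at h = c z_0. *)
  pose c := Num.min r 1.
  have c0 : 0 < c by rewrite lt_min r0 ltr01.
  pose y i := c%:C *: z (lift ord0 i).
  pose h := c%:C *: z ord0.
  have cz i : rnorm (c%:C *: z i) <= c.
    by rewrite rnormZ cabs_real ?(ltW c0)// ler_piMr// ltW.
  have c1 : c <= 1 by rewrite ge_min lexx orbT.
  have hr : rnorm h <= r by rewrite (le_trans (cz _))// ge_min lexx.
  have z1' : forall i, `|z (lift ord0 i)| <= 1 by move=> i; rewrite rnorm_le1.
  have [hA hB] := rP h hr.
  have bound M : (form_norm M <= ((e / 2) * rnorm h)%:E)%E ->
      cabs (M (fun i => z (lift ord0 i))) <= e / 2 * rnorm h.
    move=> MN; rewrite -lee_fin; apply: le_trans MN.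
    by apply: ereal_sup_ubound; exists (fun i => z (lift ord0 i)).
  have {}hA := bound _ hA; have {}hB := bound _ hB.
  have E M : multilinear M -> M (fcons h (fun i => z (lift ord0 i))) = c%:C * M z.
    move=> Mmul.
    have dE u : fcons u (fun i => z (lift ord0 i)) = dfwith z ord0 u.
      apply/funext => i; rewrite /fcons; case: unliftP => [j ->|->] /=.
        by rewrite dfwithout// neq_lift.
      by rewrite dfwithin.
    have := Mmul ord0 z c%:C (z ord0) 0; rewrite addr0 -!dE -/h => ->.
    have := Mmul ord0 z 1 0 0; rewrite scaler0 addr0 mul1r => /eqP.
    rewrite -subr_eq subrr eq_sym -dE => /eqP ->.
    by rewrite addr0 -fconsE.
  rewrite E// in hA; rewrite E// in hB.
  have := cabsD (- (G (x + h) (fun i => z (lift ord0 i)) -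
      G x (fun i => z (lift ord0 i)) - c%:C * A z))
    (G (x + h) (fun i => z (lift ord0 i)) -
      G x (fun i => z (lift ord0 i)) - c%:C * B z).
  rewrite cabsN (_ : - _ + _ = c%:C * (A z - B z)); last by ring.
  rewrite cabsM cabs_real ?(ltW c0)// => hc.
  rewrite -(ler_pM2l c0); apply: le_trans hc _.
  apply: le_trans (lerD hA hB) _.
  rewrite -mulrDl -splitr mulrC ler_wpM2r// ?(ltW e0)//.
  exact: cz.
apply/funext => z.
(* Division by [s] brings all arguments into the unit ball, and homogeneity restores the general
   case. *)
pose s : R := 1 + \sum_i rnorm (z i).
have s0 : 0 < s by rewrite ltr_wpDr// sumr_ge0// => i _; exact: rnorm_ge0.
have sC : s%:C != 0 :> R[i] by rewrite gt_eqF// ltr0_realc.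
have zE : z = fun i => s%:C *: ((s^-1)%:C *: z i).
  apply/funext => i; rewrite scalerA -rmorphM/= divff ?gt_eqF// scale1r//.
rewrite zE (multilinearZ _ _ Amul) (multilinearZ _ _ Bmul) key// => i.
rewrite rnormZ cabs_real ?invr_ge0 ?(ltW s0)// mulrC ler_pdivrMr// mul1r.
rewrite /s (bigD1 i)//= addrCA lerDl addr_ge0// sumr_ge0// => j _.
exact: rnorm_ge0.
Qed.

(** By induction on [k], [poly_derivative] is a derivative of its predecessor; by uniqueness it is
    the one that [xget] selects. *)
Lemma frechetE m (L : ('I_m -> X) -> R[i]) (P : X -> R[i]) k :
  multilinear L -> Defs.symmetric_form L -> continuous_form L ->
  (forall x, P x = L (fun=> x)) -> (k <= m)%N ->
  @frechet R X k P = @poly_derivative R X m L k.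
Proof.
move=> Lmul Lsym Lcont PL; elim: k => [|k IH] km.
  apply/funext => x; apply/funext => y /=.
  rewrite PL /poly_derivative mul1r subn0 codomE.
  rewrite (_ : [seq y i | i <- enum 'I_0] = [::]); last first.
    by apply: size0nil; rewrite size_map size_enum_ord.
  by rewrite /seq_form; congr L; apply/funext => i; rewrite /seq_fun nth_nseq ltn_ord.
apply/funext => x /=; rewrite IH ?(ltnW km)//.
apply: xget_unique; first exact: poly_derivative_frechet.
move=> A AD; apply: (is_frechet_derivative_unique AD).
exact: poly_derivative_frechet.
Qed.

Lemma frechet_polynomialE m (L : ('I_m -> X) -> R[i]) (P : X -> R[i]) k x y :
  multilinear L -> Defs.symmetric_form L -> continuous_form L ->
  (forall x, P x = L (fun=> x)) -> (k <= m)%N ->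
  frechet_polynomial k P x y =
    k`!%:R * ('C(m, k)%:R * seq_form L (nseq k y ++ nseq (m - k) x)).
Proof.
move=> Lmul Lsym Lcont PL km.
rewrite /frechet_polynomial (frechetE Lmul Lsym Lcont PL km) /poly_derivative.
rewrite mulrA -natrM mulnC bin_ffact; congr (_ * seq_form _ (_ ++ _)).
rewrite codomE -[in RHS](size_enum_ord k).
by elim: (enum 'I_k) => //= a l ->.
Qed.

End frechet_unique.

(** * The polarization estimate *)

Section polarization.
Variables (R : realType) (X : normedModType R[i]) (m : nat).
Variable L : ('I_m -> X) -> R[i].
Hypotheses (Lmul : multilinear L) (Lsym : Defs.symmetric_form L).
Variables (r M : R).
Hypotheses (m0 : (0 < m)%N) (r0 : 0 < r) (M0 : 0 <= M).
Hypothesis two_point : forall u v : X,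
  rnorm (u + v) ^+ m + rnorm (u - v) ^+ m <=
  2 * (rnorm u `^ r + rnorm v `^ r) `^ (m%:R / r).
Hypothesis LM : forall z : X, cabs (L (fun=> z)) <= M * rnorm z ^+ m.

Lemma cabs_prim_root (n : nat) (z : R[i]) : (n.+1).-primitive_root z ->
  cabs z = 1.
Proof.
move=> zn; apply/eqP; rewrite -(@pexpr_eq1 _ _ n.+1)// ?cabs_ge0// -cabsX.
by rewrite (prim_expr_order zn) (cabs_nat R 1).
Qed.

(** Triangle inequality in the Fourier extraction, with m + 1 roots because their number must exceed
    m. *)
Lemma seq_form_le_extract (x y : X) (z : R[i]) k : (k <= m)%N ->
  (m.+1).-primitive_root z ->
  m.+1%:R * ('C(m, k)%:R * cabs (seq_form L (nseq k y ++ nseq (m - k) x))) <=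
  M * \sum_(i < m.+1) rnorm (x + z ^+ i *: y) ^+ m.
Proof.
move=> km zm; have z1 := cabs_prim_root zm.
rewrite -(cabs_nat R m.+1) -(cabs_nat R 'C(m, k)) -!cabsM.
rewrite -(seq_form_extract Lmul Lsym _ _ zm)//.
apply: le_trans (cabs_sum _ _ _) _; rewrite mulr_sumr; apply: ler_sum => i _.
by rewrite cabsM !cabsX z1 !expr1n mul1r.
Qed.

(** Replacing y by -y changes the form only by a sign. Adding the two estimates pairs x + wy with x
    - wy for each root w, even when m + 1 is odd, and the two-point inequality bounds each pair by
    2. *)
Lemma seq_form_le_unit (x y : X) k : (k <= m)%N ->
  rnorm x `^ r + rnorm y `^ r <= 1 ->
  'C(m, k)%:R * cabs (seq_form L (nseq k y ++ nseq (m - k) x)) <= M.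
Proof.
move=> km xy1; have [z zm] := prim_root_exists R[i] (ltn0Sn m).
have z1 := cabs_prim_root zm.
set T := _ * cabs _.
have hp := seq_form_le_extract x y km zm; rewrite -/T in hp.
have hm := seq_form_le_extract x (- y) km zm.
have TN : 'C(m, k)%:R * cabs (seq_form L (nseq k (- y) ++ nseq (m - k) x)) = T.
  rewrite /T -scaleN1r -[x in LHS]scale1r seq_form_nseq2Z ?subnKC//.
  by rewrite expr1n mul1r cabsM cabsX cabsN (cabs_nat R 1) expr1n mul1r.
rewrite TN in hm.
have pt i : rnorm (x + z ^+ i *: y) ^+ m + rnorm (x + z ^+ i *: - y) ^+ m <= 2.
  rewrite scalerN; apply: le_trans (two_point _ _) _.
  rewrite rnormZ cabsX z1 expr1n mul1r -[leRHS]mulr1 ler_wpM2l//.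
  rewrite -[leRHS](one_powR (m%:R / r)) ge0_ler_powR ?nnegrE ?addr_ge0 ?powR_ge0//.
  by rewrite divr_ge0// ltW.
have m10 : 0 < m.+1%:R :> R by rewrite ltr0n.
have : m.+1%:R * T + m.+1%:R * T <= M * (m.+1%:R * 2).
  apply: le_trans (lerD hp hm) _.
  rewrite -mulrDr ler_wpM2l// -big_split/=.
  apply: le_trans (ler_sum _ (fun (i : 'I_m.+1) _ => pt i)) _.
  by rewrite sumr_const card_ord mulr_natl.
move=> h; rewrite -(ler_pM2l m10).
have e : M * (m.+1%:R * 2) = 2 * (m.+1%:R * M) by ring.
by move: h; rewrite e; move: (m.+1%:R * T) (m.+1%:R * M) => A B; lra.
Qed.

(** The previous bound is applied to a x and b y, and the factor a^(m-k) b^k is divided out. *)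
Lemma polarization_estimate (x y : X) k : (k <= m)%N ->
  rnorm x <= 1 -> rnorm y <= 1 ->
  'C(m, k)%:R * cabs (seq_form L (nseq k y ++ nseq (m - k) x)) <=
  m%:R `^ (m%:R / r) /
    ((m - k)%:R `^ ((m - k)%:R / r) * k%:R `^ (k%:R / r)) * M.
Proof.
move=> km x1 y1.
have m0' : 0 < m%:R :> R by rewrite ltr0n.
have mn0 : m%:R != 0 :> R by rewrite gt_eqF.
have rn0 : r != 0 by rewrite gt_eqF.
(* These are a^r and b^r; under a^r + b^r = 1 this choice maximizes a^(m-k) b^k. *)
pose al : R := (m - k)%:R / m%:R; pose be : R := k%:R / m%:R.
have al0 : 0 <= al by rewrite divr_ge0.
have be0 : 0 <= be by rewrite divr_ge0.
have albe : al + be = 1 by rewrite -mulrDl -natrD subnK// divff.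
pose a := al `^ r^-1; pose b := be `^ r^-1.
have a0 : 0 <= a by exact: powR_ge0.
have b0 : 0 <= b by exact: powR_ge0.
have scale1 c (u : X) : 0 <= c -> rnorm u <= 1 ->
    rnorm ((c `^ r^-1)%:C *: u) `^ r <= c.
  move=> c0 u1; rewrite rnormZ cabs_real ?powR_ge0//.
  rewrite powRM ?powR_ge0 ?rnorm_ge0// -powRrM mulVf// powRr1// ler_piMr//.
  rewrite -[leRHS](one_powR r) ge0_ler_powR ?nnegrE ?rnorm_ge0//.
  exact: ltW.
have xy : rnorm (a%:C *: x) `^ r + rnorm (b%:C *: y) `^ r <= 1.
  by rewrite -[leRHS]albe lerD// scale1.
have := seq_form_le_unit km xy.
rewrite seq_form_nseq2Z ?subnKC// cabsM cabsM !cabsX !cabs_real// mulrCA.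
have mV s : m%:R^-1 `^ s = (m%:R `^ s)^-1 :> R.
  by rewrite -[X in X^-1 `^ _](powRr1 (ltW m0')) -powRN -powRrM mulN1r powRN.
have powX (c : nat) n : ((c%:R / m%:R) `^ r^-1) ^+ n =
    c%:R `^ (n%:R / r) / m%:R `^ (n%:R / r) :> R.
  rewrite -powR_mulrn ?powR_ge0// -powRrM [r^-1 * _]mulrC powRM ?invr_ge0//.
  by rewrite mV.
rewrite /a /b /al /be !powX.
have pos (n : nat) := powR_nat_self_gt0 n r.
have mE : m%:R `^ (m%:R / r) =
    m%:R `^ ((m - k)%:R / r) * m%:R `^ (k%:R / r) :> R.
  by rewrite -powRD ?mn0 ?implybT// -mulrDl -natrD subnK.
rewrite mE; have := pos (m - k)%N; have := pos k.
have := powR_gt0 ((m - k)%:R / r) m0'; have := powR_gt0 (k%:R / r) m0'.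
move: (m%:R `^ _) (m%:R `^ _) (k%:R `^ _) ((m - k)%:R `^ _) => E D B A.
move: (_ * cabs _) => Z E0 D0 B0 A0 h.
rewrite mulrC -ler_pdivrMr ?divr_gt0 ?mulr_gt0//.
apply: le_trans h; rewrite le_eqVlt; apply/orP; left; apply/eqP.
by field; rewrite !gt_eqF.
Qed.

End polarization.

(** * From the exponent q to the exponent m in L_p *)

Section Lp_two_point.
Context d (T : measurableType d) (R : realType).
Variables (mu : {measure set T -> \bar R}).

(** Power mean inequality: with c = q/m >= 1, the c-th power of the mean of A1^m and A2^m is at most
    the mean of A1^q and A2^q. *)
Lemma power_mean_le (q B A1 A2 s : R) (m : nat) : (0 < m)%N -> m%:R <= q ->
  0 <= A1 -> 0 <= A2 -> 0 <= B ->
  A1 `^ q + A2 `^ q <= 2 * B `^ (q * s) ->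
  A1 ^+ m + A2 ^+ m <= 2 * B `^ (m%:R * s).
Proof.
move=> m0 mq A10 A20 B0 h.
have m0' : 0 < m%:R :> R by rewrite ltr0n.
have mn0 : m%:R != 0 :> R by rewrite gt_eqF.
have q0 : 0 < q by exact: lt_le_trans mq.
pose c := q / m%:R.
have c1 : 1 <= c by rewrite ler_pdivlMr// mul1r.
have cX u : 0 <= u -> (u ^+ m) `^ c = u `^ q.
  by move=> u0; rewrite -powR_mulrn// -powRrM mulrC divfK.
pose x := (A1 ^+ m + A2 ^+ m) / 2.
have x0 : 0 <= x by rewrite divr_ge0 ?addr_ge0 ?exprn_ge0.
have xc : x `^ c + x `^ c <= A1 `^ q + A2 `^ q.
  rewrite -!cX//; have [A12|A21] := leP A1 A2.
    rewrite [leRHS]addrC; have A12m : A1 ^+ m <= A2 ^+ m by rewrite lerXn2r.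
    by apply: powR_majorization; rewrite ?exprn_ge0//; rewrite /x; lra.
  have A21m : A2 ^+ m <= A1 ^+ m by rewrite lerXn2r// ltW.
  by apply: powR_majorization; rewrite ?exprn_ge0//; rewrite /x; lra.
have xB : x `^ c <= B `^ (q * s) by lra.
have c0 : 0 < c by lra.
have cn0 : c != 0 by rewrite gt_eqF.
have xBm : x <= B `^ (m%:R * s).
  have -> : m%:R * s = (q * s) / c by rewrite /c; field; rewrite !gt_eqF.
  rewrite -[leLHS](powRr1 x0) -[X in _ `^ X <= _](divff cn0) [leLHS]powRrM.
  rewrite [leRHS]powRrM ge0_ler_powR ?nnegrE ?powR_ge0//.
  by rewrite invr_ge0 ltW.
have -> : A1 ^+ m + A2 ^+ m = 2 * x by rewrite /x; field.
by rewrite ler_pM2l.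
Qed.

Lemma rnorm_cLspace (p : \bar R) (p1 : (1 <= p)%E) (f : cLfunType mu p1) :
  rnorm (\pi_(cLspace mu p1)%qT f) = fine (cLnorm mu p f).
Proof.
by apply: complexI; rewrite rnormE; exact: cLspace_normE.
Qed.

Lemma hoelder_conjugate_nat (m : nat) : (2 <= m)%N ->
  hoelder_conjugate (m%:R%:E : \bar R) = (m%:R / (m%:R - 1))%:E.
Proof.
move=> m2; have m2' : 2 <= m%:R :> R by rewrite ler_nat.
rewrite /hoelder_conjugate/= eqe gt_eqF; last by lra.
rewrite -EFinD inver gt_eqF//; lra.
Qed.

Lemma cLspace_two_point (p : \bar R) (p1 : (1 <= p)%E) (m : nat) :
  (2 <= m)%N -> forall u v : cLspace mu p1,
  rnorm (u + v) ^+ m + rnorm (u - v) ^+ m <=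
  2 * (rnorm u `^ bound_exponent m p + rnorm v `^ bound_exponent m p) `^
    (m%:R / bound_exponent m p).
Proof.
move=> m2; have m0 : (0 < m)%N by exact: leq_trans m2.
have m2' : 2 <= m%:R :> R by rewrite ler_nat.
rewrite /bound_exponent hoelder_conjugate_nat//.
have m'2 : m%:R / (m%:R - 1) <= 2 :> R by rewrite ler_pdivrMr; lra.
(* For infinite p the exponent is 1, and the triangle inequality suffices. *)
case: p p1 => [p p1|p1 u v|//]; last first.
  rewrite !leye_eq/=.
  have nn (w : cLspace mu p1) := rnorm_ge0 w.
  rewrite !powRr1// invr1 mulr1 powR_mulrn ?addr_ge0// mulr_natl mulr2n.
  apply: lerD; rewrite lerXn2r// ?nnegrE ?addr_ge0//; first exact: rnormD.
  by rewrite (le_trans (rnormD _ _))// lerD2l -scaleN1r rnormZ cabsN (cabs_nat R 1) mul1r.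
have p1' : 1 <= p by rewrite -lee_fin.
rewrite !lee_fin; elim/quotW => f; elim/quotW => g.
have ED : \pi_(cLspace mu p1)%qT f + \pi_(cLspace mu p1)%qT g =
  \pi_(cLspace mu p1)%qT (f + g) by exact: pi_cLspaceD.
have EN : - \pi_(cLspace mu p1)%qT g = \pi_(cLspace mu p1)%qT (- g).
  exact: pi_cLspaceN.
have EB : \pi_(cLspace mu p1)%qT f - \pi_(cLspace mu p1)%qT g =
  \pi_(cLspace mu p1)%qT (f - g) by rewrite EN; exact: pi_cLspaceD.
rewrite ED EB !rnorm_cLspace.
have H q (pq : p <= q) (q2 : 2 <= q) := cLnorm_clarkson p1' pq q2
  (cLfunType_measurable f) (cLfunType_measurable g)
  (cLfunType_finite f) (cLfunType_finite g).
have nn (h : T -> R[i]) : 0 <= fine (cLnorm mu p%:E h).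
  by rewrite fine_ge0// Lnorm_ge0.
have mean q s : p <= q -> m%:R <= q -> s = Num.min p (q / (q - 1)) ->
    fine (cLnorm mu p%:E (f + g)) ^+ m + fine (cLnorm mu p%:E (f - g)) ^+ m <=
    2 * (fine (cLnorm mu p%:E f) `^ s + fine (cLnorm mu p%:E g) `^ s) `^ (m%:R / s).
  move=> pq mq ->; apply: (power_mean_le m0 mq); rewrite ?addr_ge0 ?powR_ge0//.
  by apply: H => //; exact: le_trans mq.
have [pm'|m'p] := leP p (m%:R / (m%:R - 1)).
  (* Here p <= m' <= 2 <= m, so q = m is admissible. *)
  apply: (mean m%:R) => //; first lra.
  by rewrite (min_idPl pm').
have [pm|mp] := leP p m%:R.
  by apply: (mean m%:R) => //=; rewrite (min_idPr (ltW m'p)).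
have -> : fine (hoelder_conjugate p%:E : \bar R) = p / (p - 1).
  rewrite /hoelder_conjugate/= eqe gt_eqF; last by lra.
  by rewrite -EFinD inver gt_eqF//; lra.
(* Here q = p, and p > m >= 2 makes p' the smaller of p and p'. *)
apply: (mean p) => //; first exact: ltW.
by rewrite (min_idPr _)// ler_pdivrMr; nra.
Qed.

End Lp_two_point.

(** * The upper bound for the derivative *)

Section upper_bound.
Context d (T : measurableType d) (R : realType).
Variables (mu : {measure set T -> \bar R}) (p : \bar R) (p1 : (1 <= p)%E).
Variables (m k : nat).
Hypotheses (m2 : (2 <= m)%N) (km : (k <= m)%N).

Lemma bound_exponent_gt0 : 0 < bound_exponent m p.
Proof.
have m2' : 2 <= m%:R :> R by rewrite ler_nat.
rewrite /bound_exponent hoelder_conjugate_nat//.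
have m'0 : 0 < m%:R / (m%:R - 1) :> R by rewrite divr_gt0; lra.
case: p p1 => [q|_|//]; last by rewrite !leye_eq/= ltr01.
rewrite !lee_fin => q1; have [_|] := leP q (m%:R / (m%:R - 1)).
  by rewrite (lt_le_trans ltr01).
have [//|mq _] := leP q m%:R.
rewrite /hoelder_conjugate/= eqe gt_eqF; last by lra.
rewrite -EFinD inver gt_eqF/= ?divr_gt0//; lra.
Qed.

Lemma frechet_norm_le (P : cLspace mu p1 -> R[i]) :
  continuous_homogeneous_polynomial m P ->
  (frechet_norm k P <= (bound_constant k m p)%:E * poly_norm P)%E.
Proof.
move=> [L [Lmul Lsym Lcont PL]].
have m0 : (0 < m)%N by exact: leq_trans m2.
have r0 := bound_exponent_gt0.
have C0 : 0 < bound_constant k m p.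
  by rewrite divr_gt0 ?mulr_gt0 ?powR_nat_self_gt0// ltr0n fact_gt0.
have P0 := poly_norm_ge0 P.
(* An infinite norm makes the bound trivial, since the constant is positive. *)
have [->|Pfin] := eqVneq (poly_norm P) +oo%E; first by rewrite gt0_muley ?lte_fin// leey.
have {}Pfin : poly_norm P \is a fin_num by rewrite ge0_fin_numE// ltey.
set M := fine (poly_norm P).
have M0 : 0 <= M by exact: fine_ge0.
have PM z : rnorm z <= 1 -> cabs (P z) <= M.
  move=> z1; rewrite -lee_fin fineK//; apply: ereal_sup_ubound; exists z => //=.
  by rewrite rnorm_le1.
have LM z : cabs (L (fun=> z)) <= M * rnorm z ^+ m.
  have [->|z0] := eqVneq z 0.
    rewrite rnorm0 -(scale0r 0) (multilinearZ 0 _ Lmul) expr0n gtn_eqF//.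
    by rewrite mul0r /cabs normr0 expr0n gtn_eqF// mulr0.
  have rz := rnorm_gt0 z0.
  have zE : z = (rnorm z)%:C *: ((rnorm z)^-1%:C *: z).
    by rewrite scalerA -rmorphM/= divff ?gt_eqF// scale1r.
  rewrite {1}zE (multilinearZ _ _ Lmul) -PL cabsM cabsX cabs_real ?rnorm_ge0//.
  rewrite mulrC ler_wpM2r ?exprn_ge0 ?rnorm_ge0// PM//.
  by rewrite rnormZ cabs_real ?invr_ge0 ?rnorm_ge0// mulVf ?gt_eqF.
apply: ge_ereal_sup => _ [x /= x1 <-]; apply: ge_ereal_sup => _ [y /= y1 <-].
rewrite (frechet_polynomialE _ _ Lmul Lsym Lcont PL km).
rewrite -(fineK Pfin) -/M -EFinM lee_fin cabsM cabs_nat cabsM cabs_nat.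
rewrite /bound_constant -!mulrA ler_wpM2l// !mulrA.
rewrite rnorm_le1 in x1; rewrite rnorm_le1 in y1.
exact: (polarization_estimate Lmul Lsym m0 r0 M0
  (@cLspace_two_point _ _ _ mu _ p1 _ m2) LM km x1 y1).
Qed.

End upper_bound.

(** * Sharpness *)

Section continuous_big.
Variables (R : realType) (Y : topologicalType) (I : Type) (r : seq I).
Variable F : I -> Y -> R[i]^o.
Hypothesis Fcont : forall i, continuous (F i).

Lemma continuous_bigprod :
  continuous ((fun y => \prod_(i <- r) F i y) : Y -> R[i]^o).
Proof.
elim: r => [|i s IH] y.
  have -> : (fun y => \prod_(i <- [::]) F i y) = cst 1.
    by apply/funext => z; rewrite big_nil.
  exact: cvg_cst.
have -> : (fun y => \prod_(j <- i :: s) F j y) =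
    (fun y => F i y * \prod_(j <- s) F j y).
  by apply/funext => z; rewrite big_cons.
exact: (cvgM (@Fcont i y) (IH y)).
Qed.

Lemma continuous_bigsum :
  continuous ((fun y => \sum_(i <- r) F i y) : Y -> R[i]^o).
Proof.
elim: r => [|i s IH] y.
  have -> : (fun y => \sum_(i <- [::]) F i y) = cst 0.
    by apply/funext => z; rewrite big_nil.
  exact: cvg_cst.
have -> : (fun y => \sum_(j <- i :: s) F j y) =
    (fun y => F i y + \sum_(j <- s) F j y).
  by apply/funext => z; rewrite big_cons.
exact: (cvgD (@Fcont i y) (IH y)).
Qed.

End continuous_big.

Section monomial_form.
Variables (R : realType) (X : normedModType R[i]) (c : bool -> X -> R[i]).
Hypothesis clin : forall b (a : R[i]) u v, c b (a *: u + v) = a * c b u + c b v.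
Hypothesis cbound : forall b u, cabs (c b u) <= rnorm u.
Variables (m k : nat).
Hypothesis km : (k <= m)%N.

(** The polar form of (c true z)^k (c false z)^(m-k): the product is averaged over all permutations,
    which choose the [k] slots that receive [c true]. *)
Definition monomial_form (y : 'I_m -> X) : R[i] :=
  (m`!%:R)^-1 * \sum_(s : 'S_m) \prod_(i < m) c (s i < k)%N (y i).

Lemma monomial_form_multilinear : multilinear monomial_form.
Proof.
move=> i y a u v; rewrite /monomial_form mulrCA -mulrDr; congr (_ * _).
rewrite mulr_sumr -big_split/=; apply: eq_bigr => s _.
have D w : \prod_(j < m) c (s j < k)%N (dfwith y i w j) =
    c (s i < k)%N w * \prod_(j < m | j != i) c (s j < k)%N (y j).
  rewrite (bigD1 i)//= dfwithin; congr (_ * _).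
  by apply: eq_bigr => j ji; rewrite dfwithout// eq_sym.
by rewrite (D (a *: u + v)) (D u) (D v) clin mulrDl mulrA.
Qed.

Lemma monomial_form_symmetric : Defs.symmetric_form monomial_form.
Proof.
move=> t y; rewrite /monomial_form; congr (_ * _).
rewrite (reindex_inj (mulgI t)); apply: eq_bigr => s _.
rewrite [RHS](reindex_inj (@perm_inj _ t)); apply: eq_bigr => i _ /=.
by rewrite permM.
Qed.

Lemma coordinate_continuous b : continuous (c b : X -> R[i]^o).
Proof.
move=> u; apply/pseudometric_normed_Zmodule.cvgrPdist_le => e e0.
have eE : e = (complex.Re e)%:C by rewrite RRe_real// gtr0_real.
have re0 : 0 < complex.Re e by rewrite -ltr0_realc -eE.
have cB v : c b u - c b v = c b (u - v).
  have -> : u - v = -1 *: v + u by rewrite scaleN1r addrC.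
  by rewrite clin mulN1r addrC.
apply/nbhs0P; have := near0_rnorm_le X re0; apply: filterS => h he.
rewrite cB opprD addrA subrr sub0r eE -cabsE lecR.
by rewrite (le_trans (cbound _ _))// -scaleN1r rnormZ cabsN (cabs_nat R 1) mul1r.
Qed.

Lemma monomial_form_continuous : continuous_form monomial_form.
Proof.
have cP (s : 'S_m) (i : 'I_m) : continuous
    ((fun y => c (s i < k)%N (y i)) : {ptws 'I_m -> X} -> R[i]^o).
  move=> y W Wy.
  have cW := @coordinate_continuous (s i < k)%N (y i) W Wy.
  exact: (@proj_continuous 'I_m (fun=> X) i y _ cW).
have cS := @continuous_bigsum R _ _ (index_enum 'S_m) _
  (fun s => @continuous_bigprod R _ _ (index_enum 'I_m) _ (cP s)).
by move=> y; exact: (cvgM (cvg_cst _) (cS y)).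
Qed.

Lemma bigif_split (S : Type) (idx : S) (op : Monoid.law idx) (a b : S) n :
  \big[op/idx]_(i < k + n) (if (i < k)%N then a else b) =
  op (\big[op/idx]_(i < k) a) (\big[op/idx]_(i < n) b).
Proof.
rewrite big_split_ord/=; congr (op _ _); apply: eq_bigr => i _.
  by rewrite /= ltn_ord.
by rewrite /= ltnNge leq_addr.
Qed.

(** On the diagonal, reindexing by the permutation makes all summands equal. *)
Lemma monomial_form_diag z :
  monomial_form (fun=> z) = c true z ^+ k * c false z ^+ (m - k).
Proof.
rewrite /monomial_form.
have E (s : 'S_m) : \prod_(i < m) c (s i < k)%N z = c true z ^+ k * c false z ^+ (m - k).
  transitivity (\prod_(j < m) c (j < k)%N z).
    by rewrite [RHS](reindex_inj (@perm_inj _ s)).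
  transitivity (\prod_(j < m) (if (j < k)%N then c true z else c false z)).
    by apply: eq_bigr => j _; case: ltnP.
  have G m' : m' = (k + (m - k))%N ->
      \prod_(j < m') (if (j < k)%N then c true z else c false z) =
      c true z ^+ k * c false z ^+ (m - k).
    by move=> ->; rewrite bigif_split !prodr_const !card_ord.
  by apply: G; rewrite subnKC.
under eq_bigr => s _ do rewrite E.
rewrite sumr_const card_Sn mulrnAr -[_ *+ _]mulr_natl mulrA divff ?mul1r//.
Qed.

(** At x + w y the monomial equals w^k, so every term of the Fourier sum that extracts the
    coefficient of degree [k] is 1. *)
Lemma monomial_form_basis x y : c true x = 0 -> c false x = 1 ->
  c true y = 1 -> c false y = 0 ->
  'C(m, k)%:R * seq_form monomial_form (nseq k y ++ nseq (m - k) x) = 1.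
Proof.
move=> tx fx ty fy; have [z zm] := prim_root_exists R[i] (ltn0Sn m).
have := seq_form_extract monomial_form_multilinear monomial_form_symmetric x y zm
  (ltnSn m) km.
under eq_bigr => i _.
  rewrite monomial_form_diag addrC !clin tx fx ty fy addr0 mulr0 add0r mulr1.
  rewrite expr1n mulr1 -exprD subnK ?(leq_trans km)// -exprM mulnC exprM.
  rewrite (prim_expr_order zm) expr1n.
  over.
rewrite sumr_const card_ord => h.
have m1 : m.+1%:R != 0 :> R[i] by rewrite pnatr_eq0.
by apply: (mulfI m1); rewrite -h mulr1.
Qed.

End monomial_form.

(** The AM-GM inequality for k copies of s/k and n copies of t/n, whose sum is at most 1; for n = 0
    the second block is empty. *)
Lemma weighted_AGM (R : realType) (k n : nat) (s t : R) : (0 < k)%N ->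
  0 <= s -> 0 <= t -> s + t <= 1 ->
  s ^+ k * t ^+ n * (k + n)%:R ^+ (k + n) <= k%:R ^+ k * n%:R ^+ n.
Proof.
move=> k0 s0 t0 st1.
pose E (i : 'I_(k + n)) := if (i < k)%N then s / k%:R else t / n%:R.
have E0 i : 0 <= E i by rewrite /E; case: ifP => _; rewrite divr_ge0.
have k0' : k%:R != 0 :> R by rewrite pnatr_eq0 -lt0n.
have sE : \sum_i E i <= 1.
  rewrite /E bigif_split !sumr_const !card_ord -[(s / _) *+ _]mulr_natr divfK//.
  apply: le_trans st1; rewrite lerD2l; case: n {E E0} => [|n]; first by rewrite mulr0n.
  by rewrite -[(t / _) *+ _]mulr_natr divfK// pnatr_eq0.
have := (@leif_AGM_scaled _ _ xpredT E _).1.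
rewrite card_ord => /(_ (fun i _ => mulrn_wge0 _ (E0 i))) h.
have {}h : \prod_i (E i *+ (k + n)) <= 1.
  apply: le_trans h _; apply: exprn_ile1 => //.
  by apply: sumr_ge0 => i _; exact: E0.
move: h.
rewrite (eq_bigr (fun i : 'I_(k + n) => if (i < k)%N then (k + n)%:R * (s / k%:R)
   else (k + n)%:R * (t / n%:R))); last first.
  by move=> i _; rewrite -mulr_natl /E; case: ifP.
rewrite bigif_split !prodr_const !card_ord !exprMn !exprVn exprD => h.
have kk : 0 < k%:R ^+ k :> R by rewrite exprn_gt0// ltr0n.
have nn : 0 < n%:R ^+ n :> R by case: n {E E0 sE h} => [|n]; rewrite ?expr0// exprn_gt0// ltr0n.
rewrite -[leRHS]mul1r -ler_pdivrMr ?mulr_gt0//.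
apply: le_trans h; rewrite le_eqVlt; apply/orP; left; apply/eqP.
by rewrite /=; field; rewrite !gt_eqF.
Qed.

(** * The two-dimensional l_q as a space of classes of functions *)

Section two_atoms.
Variable R : realType.

(** Unit mass at each of two points, so that the norm is that of l_q in dimension two. *)
Definition two_atoms : {measure set bool -> \bar R} :=
  measure_add (\d_true : {measure set bool -> \bar R}) \d_false.

(** Both points have positive mass, so null sets are empty; hence evaluation at an atom is well
    defined on classes. *)
Lemma two_atoms_ae (f g : bool -> R[i]) : f = g %[ae two_atoms] -> f =1 g.
Proof.
move=> [N [mN N0 fgN]] b; apply: contrapT => fgb.
have Nb : N b by apply: fgN => /= /(_ I).
have : (\d_true N + \d_false N = 0 :> \bar R)%E by rewrite -measure_addE.
rewrite !diracE => /eqP; rewrite padde_eq0 ?lee_fin ?ler0n//.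
by case: b Nb fgb => /mem_set -> _; rewrite !eqe oner_eq0 ?andbF.
Qed.

Lemma integral_two_atoms (f : bool -> R) : (forall b, 0 <= f b) ->
  (\int[two_atoms]_b (f b)%:E = (f true + f false)%:E)%E.
Proof.
move=> f0; rewrite ge0_integral_measure_add//; last by move=> b _; rewrite lee_fin.
by rewrite !integral_dirac// !diracT !mul1e.
Qed.

Variables (q : R) (q1 : (1 <= q%:E)%E).
Let q1' : 1 <= q. Proof. by rewrite -lee_fin. Qed.
Let X := cLspace two_atoms q1.

Lemma two_atoms_cLfun (f : bool -> R[i]) : f \in cLfun two_atoms q1.
Proof.
apply/cLfunP; split; first by [].
rewrite cLnorm_EFin// integral_two_atoms; last by move=> b; exact: powR_ge0.
by apply: poweR_lty; exact: ltry.
Qed.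

Definition two_atoms_vec (f : bool -> R[i]) : X :=
  \pi_X%qT (CLfunType (two_atoms_cLfun f)).

Definition atom_coord (b : bool) (u : X) : R[i] := repr u b.

Lemma atom_coord_pi b (f : cLfunType two_atoms q1) :
  atom_coord b (\pi_X%qT f) = f b.
Proof. exact: (two_atoms_ae (cLspace_repr f)). Qed.

Lemma atom_coord_lin b (a : R[i]) u v :
  atom_coord b (a *: u + v) = a * atom_coord b u + atom_coord b v.
Proof.
elim/quotW: u => f; elim/quotW: v => g.
have -> : a *: \pi_X%qT f + \pi_X%qT g = \pi_X%qT (a *: f + g).
  have -> : a *: \pi_X%qT f = \pi_X%qT (a *: f) by exact: pi_cLspaceZ.
  exact: pi_cLspaceD.
by rewrite !atom_coord_pi.
Qed.

Lemma rnorm_two_atoms (u : X) :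
  rnorm u `^ q = cabs (atom_coord true u) `^ q + cabs (atom_coord false u) `^ q.
Proof.
elim/quotW: u => f; rewrite rnorm_cLspace !atom_coord_pi; apply: EFin_inj.
rewrite -(integral_cabs_powR q1' (cLfunType_finite f)).
by rewrite integral_two_atoms// => b; exact: powR_ge0.
Qed.

Let q0 : 0 < q. Proof. exact: lt_le_trans q1'. Qed.

Lemma powR_le_inv (a b : R) : 0 <= a -> 0 <= b -> a `^ q <= b `^ q -> a <= b.
Proof.
move=> a0 b0; apply: contraTT; rewrite -!ltNge => ba.
by rewrite gt0_ltr_powR// nnegrE.
Qed.

Lemma atom_coord_le b (u : X) : cabs (atom_coord b u) <= rnorm u.
Proof.
apply: powR_le_inv; rewrite ?cabs_ge0 ?rnorm_ge0// rnorm_two_atoms.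
by case: b; rewrite ?lerDl ?lerDr powR_ge0.
Qed.

Lemma rnorm_two_atoms_vec (b : bool) :
  rnorm (two_atoms_vec (fun b' => (b == b')%:R)) <= 1.
Proof.
apply: powR_le_inv; rewrite ?rnorm_ge0// rnorm_two_atoms !atom_coord_pi one_powR.
by case: b; rewrite /= (cabs_nat R 1) (cabs_nat R 0) one_powR powR0 ?gt_eqF//
  ?addr0 ?add0r.
Qed.

(** The two basis vectors give the value k! to the derivative of the monomial, while AM-GM applied
    to the q-th powers of the coordinates bounds its norm. *)
Lemma two_atoms_sharp (m k : nat) : (0 < k)%N -> (k <= m)%N -> (0 < m)%N ->
  exists2 P : X -> R[i], continuous_homogeneous_polynomial m P &
    (k`!%:R%:E <= frechet_norm k P)%E /\
    (poly_norm P <= ((k%:R `^ (k%:R / q) * (m - k)%:R `^ ((m - k)%:R / q)) /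
       m%:R `^ (m%:R / q))%:E)%E.
Proof.
move=> k0 km m0; pose L := @monomial_form R X atom_coord m k.
have Lmul : multilinear L by apply: monomial_form_multilinear; exact: atom_coord_lin.
have Lsym : Defs.symmetric_form L by exact: monomial_form_symmetric.
have Lcont : continuous_form L.
  by apply: monomial_form_continuous; [exact: atom_coord_lin|exact: atom_coord_le].
pose P (z : X) := L (fun=> z).
have PE z : P z = L (fun=> z) by [].
exists P; first by exists L.
split.
  pose y := two_atoms_vec (fun b => (true == b)%:R).
  pose x := two_atoms_vec (fun b => (false == b)%:R).
  apply: le_trans (_ : (cabs (frechet_polynomial k P x y))%:E <= _)%E.
    rewrite (frechet_polynomialE x y Lmul Lsym Lcont PE km).
    rewrite monomial_form_basis ?atom_coord_pi//; last exact: atom_coord_lin.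
    by rewrite mulr1 cabs_nat.
  apply: le_trans (_ : poly_norm (frechet_polynomial k P x) <= _)%E.
    apply: ereal_sup_ubound; exists y => //=.
    by rewrite rnorm_le1; exact: rnorm_two_atoms_vec.
  apply: ereal_sup_ubound; exists x => //=.
  by rewrite rnorm_le1; exact: rnorm_two_atoms_vec.
apply: ge_ereal_sup => _ [z /= z1 <-]; rewrite lee_fin.
rewrite rnorm_le1 in z1.
rewrite PE /L monomial_form_diag// cabsM !cabsX.
have := rnorm_two_atoms z.
have := cabs_ge0 (atom_coord true z); have := cabs_ge0 (atom_coord false z).
move: (cabs _) (cabs _) => s t t0 s0 st.
have st1 : s `^ q + t `^ q <= 1.
  by rewrite -st -[leRHS](one_powR q) ge0_ler_powR ?nnegrE ?rnorm_ge0// ltW.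
have := weighted_AGM (m - k) k0 (powR_ge0 s q) (powR_ge0 t q) st1.
rewrite subnKC// => h.
have m0' : 0 < m%:R :> R by rewrite ltr0n.
(* All quantities become powers with exponent 1/q, so monotonicity of that power transfers the AM-GM
   bound. *)
have nq n : n%:R `^ (n%:R / q) = (n%:R ^+ n) `^ q^-1 :> R.
  by rewrite powRrM powR_mulrn.
have sq n u : 0 <= u -> u ^+ n = ((u `^ q) ^+ n) `^ q^-1.
  move=> u0; rewrite -powR_mulrn ?powR_ge0// -!powRrM.
  by rewrite [q * _]mulrC divfK ?gt_eqF// powR_mulrn.
rewrite !nq (sq k s)// (sq (m - k)%N t)// ler_pdivlMr ?powR_gt0 ?exprn_gt0//.
rewrite -!powRM ?mulr_ge0 ?exprn_ge0 ?powR_ge0//.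
by rewrite ge0_ler_powR ?nnegrE ?mulr_ge0 ?exprn_ge0 ?powR_ge0 ?invr_ge0// ltW.
Qed.

End two_atoms.

(** * The estimate and its optimality *)

Theorem proposition8 (R : realType) (m k : nat) (p : \bar R)
    (m_ge2 : (2 <= m)%N) (k_ge1 : (1 <= k)%N) (k_le_m : (k <= m)%N)
    (p_ge1 : (1 <= p)%E) :
  (forall (d : measure_display) (T : measurableType d)
      (mu : {measure set T -> \bar R}) (P : cLspace mu p_ge1 -> R[i]),
    continuous_homogeneous_polynomial m P ->
    (frechet_norm k P <= (bound_constant k m p)%:E * poly_norm P)%E) /\
  ((p <= hoelder_conjugate m%:R%:E)%E ->
   forall C : R,
    (forall (d : measure_display) (T : measurableType d)
        (mu : {measure set T -> \bar R}) (P : cLspace mu p_ge1 -> R[i]),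
      continuous_homogeneous_polynomial m P ->
      (frechet_norm k P <= C%:E * poly_norm P)%E) ->
    bound_constant k m p <= C).
Proof.
split=> [d T mu P|pm' C CP]; first exact: frechet_norm_le.
have m0 : (0 < m)%N by exact: leq_trans m_ge2.
rewrite /bound_constant /bound_exponent pm'.
move: pm'; rewrite hoelder_conjugate_nat//.
(* The condition p <= m' forces p to be finite. *)
case: p p_ge1 CP => [q q1 CP _|//|//] /=.
have [P PH [kP Pk]] := two_atoms_sharp q1 k_ge1 k_le_m m0.
have {CP} := CP _ _ _ P PH; move/(le_trans kP).
have P0 := poly_norm_ge0 P.
have pos (n : nat) := powR_nat_self_gt0 n q.
have Pfin : poly_norm P \is a fin_num.
  by rewrite ge0_fin_numE// (le_lt_trans Pk)// ltry.
move: P0 Pk; rewrite -(fineK Pfin) -EFinM !lee_fin.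
move: (fine _) => M M0 Mk kCM.
have k0 : 0 < k`!%:R :> R by rewrite ltr0n fact_gt0.
(* Otherwise k! <= C M <= 0. Positivity allows the bound on M to be multiplied by C. *)
have C0 : 0 < C.
  by rewrite ltNge; apply/negP => C0; move: kCM; rewrite leNgt (le_lt_trans _ k0)// mulr_le0_ge0.
have := le_trans kCM (ler_wpM2l (ltW C0) Mk).
rewrite mulrA ler_pdivlMr ?pos// [X in _ <= C * X]mulrC.
by rewrite -ler_pdivrMr ?mulr_gt0 ?pos.
Qed.
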